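(* Let $G$ be a finite acyclic directed graph. The lattice $\mathcal L(G)$ is trim if and only if the independence poset $\mathrm{top}(G)$ is a lattice, and in this case the map $\phi(x)=(\mathrm D(x),\mathrm U(x))$ is an isomorphism of posets $\mathcal L(G)\simeq\mathrm{top}(G)$.
   Context: All directed graphs are finite, acyclic (no directed cycles, hence no loops) and without multiple edges; $g\in G$ means $g$ is a vertex of $G$, and $g\to h$ denotes an edge from $g$ to $h$. The $G$-order is the partial order on vertices with $g_1\ge g_2$ iff there is a directed path (possibly of length $0$) from $g_1$ to $g_2$. An independent set is a set of pairwise non-adjacent vertices. A pair $(\mathcal D,\mathcal U)$ of disjoint independent sets is orthogonal if there is no edge from an element of $\mathcal D$ to an element of $\mathcal U$. An orthogonal pair of independent sets is tight if none of the following operations results in an orthogonal pair of independent sets: removing some $d\in\mathcal D$ and inserting in $\mathcal D$ an element $d'\notin\mathcal D$ with $d'>d$; removing some $u\in\mathcal U$ and inserting in $\mathcal U$ an element $u'\notin\mathcal U$ with $u'<u$; adding a new element to $\mathcal D$; adding a new element to $\mathcal U$. A tight orthogonal pair is called a top, and $\mathrm{top}(G)$ is the set of tops of $G$. A linear extension $\ell$ of $G$-order is a total order on the vertices such that if $g_1\to g_2$ is an edge then $g_2$ precedes $g_1$; a reverse linear extension $\ell'$ is a total order in which $g_1$ precedes $g_2$ whenever $g_1\to g_2$. Flips: for $(\mathcal D,\mathcal U)\in\mathrm{top}(G)$ and $g\in G$, define $\mathrm{flip}_g(\mathcal D,\mathcal U)=(\mathcal D,\mathcal U)$ if $g\notin\mathcal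 D\cup\mathcal U$. Otherwise start with $\mathcal D'=\{k\in\mathcal D: k\not\le g\}$ and $\mathcal U'=\{k\in\mathcal U:k\not\ge g\}$; add $g$ to $\mathcal D'$ if $g\in\mathcal U$, and add $g$ to $\mathcal U'$ if $g\in\mathcal D$. Then, for $k\not\ge g$ in the order of a reverse linear extension $\ell'$, add $k$ to $\mathcal D'$ if $k\notin\mathcal U'$, there is no edge from $k$ to $\mathcal U'$, and there is no edge from the current $\mathcal D'$ to $k$. Then, for $k\not\le g$ in the order of a linear extension $\ell$, add $k$ to $\mathcal U'$ if $k\notin\mathcal D'$, there is no edge from $\mathcal D'$ to $k$, and there is no edge from $k$ to the current $\mathcal U'$. The result $(\mathcal D',\mathcal U')$ is $\mathrm{flip}_g(\mathcal D,\mathcal U)$; it is a top and does not depend on the choice of $\ell,\ell'$. The independence poset, also denoted $\mathrm{top}(G)$, is the set $\mathrm{top}(G)$ with the reflexive and transitive closure of the relations $(\mathcal D,\mathcal U)<\mathrm{flip}_g(\mathcal D,\mathcal U)$ for $g\in\mathcal U$ (this is a partial order). Maximal orthogonal pairs: a pair $(X,Y)$ of disjoint sets of vertices (not necessarily independent) with no edge from an element of $X$ to an element of $Y$ is a maximal orthogonal pair if $X$ and $Y$ are both maximal with this property. $\mathcal L(G)$ is the set of maximal orthogonal pairs ordered by $(X,Y)\le(X',Y')$ iff $X\subseteq X'$ (equivalently $Y'\subseteq Y$); it is an extremal lattice. For $x=(X,Y)\in\mathcal L(G)$ write $x_{\mathcal J}=X$ and $x_{\mathcal M}=Y$. A chain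 $x_0<x_1<\cdots<x_r$ has length $r$. A finite lattice is extremal if the length of its longest chain equals both its number of join-irreducible elements and its number of meet-irreducible elements. An element $x$ of a lattice is left modular if $(y\vee x)\wedge z=y\vee(x\wedge z)$ for all $y\le z$; a lattice is left modular if it has a maximal chain of left modular elements. A trim lattice is an extremal left modular lattice. It is known that when $\mathcal L(G)$ is trim, for every cover $x\lessdot y$ in $\mathcal L(G)$ the set $x_{\mathcal M}\cap y_{\mathcal J}$ has exactly one element. Then $\mathrm D(y)$ is the set of the unique elements of $x_{\mathcal M}\cap y_{\mathcal J}$ over all $x\lessdot y$, and $\mathrm U(y)$ is the set of the unique elements of $y_{\mathcal M}\cap z_{\mathcal J}$ over all $z$ with $y\lessdot z$.
   Formalization: In the definition of tight, an inserted d' may replace one or more elements of D, all below d' (dually for U); if exactly one element is removed, the claim fails for the graph with edges 0→2, 1→2, 2→3, 2→4. *)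

(* Defs.v *)
From HB Require Import structures.
From mathcomp Require Import all_boot all_order.

Set Implicit Arguments.
Unset Strict Implicit.
Unset Printing Implicit Defensive.

Import Order.TTheory.

(* A finite directed graph without multiple edges is a finType V of vertices
   with a relation e : rel V, where e g h reads g -> h. A closed walk contains
   a directed cycle, so "cycle e c" need not be restricted to simple cycles;
   the case c = [:: x] excludes loops. *)

Section Graph.
Variables (V : finType) (e : rel V).
Implicit Types (A B D U X Y : {set V}) (p : {set V} * {set V}) (g k : V).

Definition acyclic : Prop := forall c : seq V, cycle e c -> c = [::].

Definition gge g1 g2 : bool := connect e g1 g2.
Definition ggt g1 g2 : bool := (g1 != g2) && gge g1 g2.

(* A total order on the vertices is given by the list of all vertices, each
   occurring once, first one first. *)
Definition linear_extension (l : seq V) : Prop :=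
  perm_eq l (enum V) /\
  forall g1 g2, e g1 g2 -> index g2 l < index g1 l.

Definition reverse_linear_extension (l : seq V) : Prop :=
  perm_eq l (enum V) /\
  forall g1 g2, e g1 g2 -> index g1 l < index g2 l.

Definition independent A : bool := [forall x in A, forall y in A, ~~ e x y].

Definition orthogonal X Y : bool :=
  [disjoint X & Y] && [forall x in X, forall y in Y, ~~ e x y].

Definition orth_indep D U : bool :=
  [&& independent D, independent U & orthogonal D U].

(* Increasing D (and dually decreasing U) inserts one vertex g that lies above
   all of the removed vertices, and one or more vertices S may be removed.
   Allowing only singletons S would admit spurious tops: in the graph
   0 -> 2, 1 -> 2, 2 -> 3, 2 -> 4 both ({3,4},{2}) and ({3,4},{0,1}) would be
   tight, although a top is to be determined by its first component. *)
Definition increase_D D U : bool :=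
  [exists S : {set V}, exists g,
    [&& S \subset D, S != set0, g \notin D, [forall d in S, ggt g d]
      & orth_indep (g |: (D :\: S)) U]].

Definition decrease_U D U : bool :=
  [exists S : {set V}, exists g,
    [&& S \subset U, S != set0, g \notin U, [forall u in S, ggt u g]
      & orth_indep D (g |: (U :\: S))]].

Definition add_D D U : bool :=
  [exists g, (g \notin D) && orth_indep (g |: D) U].

Definition add_U D U : bool :=
  [exists g, (g \notin U) && orth_indep D (g |: U)].

Definition tight p : bool :=
  [&& orth_indep p.1 p.2, ~~ increase_D p.1 p.2, ~~ decrease_U p.1 p.2,
      ~~ add_D p.1 p.2 & ~~ add_U p.1 p.2].

Record tops := Top { top_val : {set V} * {set V}; _ : tight top_val }.

HB.instance Definition _ := [isSub for top_val].
HB.instance Definition _ := [Finite of tops by <:].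

(* l is meant to be a linear extension and l' a reverse linear extension. *)
Definition flip (l l' : seq V) g p : {set V} * {set V} :=
  let: (D, U) := p in
  if g \notin D :|: U then (D, U) else
  let D0 := [set k in D | ~~ gge g k] :|: (if g \in U then [set g] else set0) in
  let U0 := [set k in U | ~~ gge k g] :|: (if g \in D then [set g] else set0) in
  let D' := foldl
    (fun (C : {set V}) k =>
       if [&& k \notin U0, [forall u in U0, ~~ e k u]
            & [forall d in C, ~~ e d k]] then k |: C else C)
    D0 [seq k <- l' | ~~ gge k g] in
  let U' := foldl
    (fun (C : {set V}) k =>
       if [&& k \notin D', [forall d in D', ~~ e d k]
            & [forall u in C, ~~ e k u]] then k |: C else C)
    U0 [seq k <- l | ~~ gge g k] in
  (D', U').

Definition flip_up (l l' : seq V) : rel tops :=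
  fun t t' => [exists g in (val t).2, flip l l' g (val t) == val t'].

(* connect is the reflexive and transitive closure *)
Definition top_le (l l' : seq V) : rel tops := connect (flip_up l l').

Definition max_orthogonal p : bool :=
  maxset (fun X => orthogonal X p.2) p.1 &&
  maxset (fun Y => orthogonal p.1 Y) p.2.

Record mop := Mop { mop_val : {set V} * {set V}; _ : max_orthogonal mop_val }.

HB.instance Definition _ := [isSub for mop_val].
HB.instance Definition _ := [Finite of mop by <:].

Definition mopJ (x : mop) : {set V} := (val x).1.
Definition mopM (x : mop) : {set V} := (val x).2.

Definition orthr X : {set V} := [set y | [forall x in X, (x != y) && ~~ e x y]].
Definition orthl Y : {set V} := [set x | [forall y in Y, (x != y) && ~~ e x y]].

Lemma orthogonalP X Y :
  reflect (forall x y, x \in X -> y \in Y -> (x != y) && ~~ e x y)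
          (orthogonal X Y).
Proof.
apply: (iffP andP) => [[dXY /'forall_in_forall_inP nXY] x y xX yY | h].
  rewrite nXY // andbT; apply: contraTneq xX => ->.
  by rewrite (disjointFl dXY yY).
split.
  rewrite disjoint_subset; apply/subsetP => x xX; rewrite inE.
  by apply/negP => /(h _ _ xX); rewrite eqxx.
by apply/'forall_in_forall_inP => x xX y yY; case/andP: (h x y xX yY).
Qed.

Lemma orthogonal_sub_orthr X Y : orthogonal X Y = (Y \subset orthr X).
Proof.
apply/orthogonalP/subsetP => [h y yY | h x y xX yY].
  by rewrite inE; apply/forall_inP => x xX; apply: h.
by have := h y yY; rewrite inE => /forall_inP; apply.
Qed.

Lemma orthogonal_sub_orthl X Y : orthogonal X Y = (X \subset orthl Y).
Proof.
apply/orthogonalP/subsetP => [h x xX | h x y xX yY].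
  by rewrite inE; apply/forall_inP => y yY; apply: h.
by have := h x xX; rewrite inE => /forall_inP; apply.
Qed.

Lemma maxset_subset A B : maxset (fun X => X \subset B) A = (A == B).
Proof.
apply/maxsetP/eqP => [[sAB h] | ->]; first exact/esym/h.
by split => // C sCB sBC; apply/eqP; rewrite eqEsubset sCB.
Qed.

Lemma max_orthogonalE p :
  max_orthogonal p = (p.1 == orthl p.2) && (p.2 == orthr p.1).
Proof.
rewrite /max_orthogonal -!maxset_subset; congr (_ && _);
  apply: maxset_eq => X.
- exact: orthogonal_sub_orthl.
- exact: orthogonal_sub_orthr.
Qed.

Lemma orth_galois X Y : (X \subset orthl Y) = (Y \subset orthr X).
Proof. by rewrite -orthogonal_sub_orthl orthogonal_sub_orthr. Qed.

Lemma mopJE x : mopJ x = orthl (mopM x).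
Proof. by case: x => p /[dup]; rewrite {1}max_orthogonalE => /andP[/eqP]. Qed.

Lemma mopME x : mopM x = orthr (mopJ x).
Proof. by case: x => p /[dup]; rewrite {1}max_orthogonalE => /andP[_ /eqP]. Qed.

Lemma orthl_closed Y : orthl (orthr (orthl Y)) = orthl Y.
Proof.
apply/eqP; rewrite eqEsubset !orth_galois subxx andbT.
have sY : Y \subset orthr (orthl Y) by rewrite -orth_galois.
by apply: (subset_trans sY); rewrite -orth_galois.
Qed.

Lemma orthr_closed X : orthr (orthl (orthr X)) = orthr X.
Proof.
apply/eqP; rewrite eqEsubset -!orth_galois subxx andbT.
have sX : X \subset orthl (orthr X) by rewrite orth_galois.
by apply: (subset_trans sX); rewrite orth_galois.
Qed.

Fact mop_of_M_subproof Y : max_orthogonal (orthl Y, orthr (orthl Y)).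
Proof. by rewrite max_orthogonalE /= orthl_closed !eqxx. Qed.

Fact mop_of_J_subproof X : max_orthogonal (orthl (orthr X), orthr X).
Proof. by rewrite max_orthogonalE /= orthr_closed !eqxx. Qed.

Definition mop_of_M Y : mop := Mop (mop_of_M_subproof Y).
Definition mop_of_J X : mop := Mop (mop_of_J_subproof X).

Definition mop_le : rel mop := fun x y => mopJ x \subset mopJ y.

Lemma mop_leM x y : mop_le x y = (mopM y \subset mopM x).
Proof. by rewrite /mop_le [mopJ y]mopJE orth_galois -mopME. Qed.

Fact mop_le_refl : reflexive mop_le.
Proof. by move=> x; apply: subxx. Qed.

Fact mop_le_anti : antisymmetric mop_le.
Proof.
move=> x y; rewrite /mop_le -eqEsubset => /eqP eJ; apply: val_inj.
rewrite [val x]surjective_pairing [val y]surjective_pairing.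
by rewrite -/(mopM x) -/(mopM y) mopME [in RHS]mopME -/(mopJ x) -/(mopJ y) eJ.
Qed.

Fact mop_le_trans : transitive mop_le.
Proof. by move=> y x z; apply: subset_trans. Qed.

Definition mop_meet (x y : mop) : mop := mop_of_M (mopM x :|: mopM y).
Definition mop_join (x y : mop) : mop := mop_of_J (mopJ x :|: mopJ y).

Fact mop_lexI x y z : mop_le x (mop_meet y z) = mop_le x y && mop_le x z.
Proof. by rewrite {1}/mop_le /mopJ /= orth_galois subUset -mopME -!mop_leM. Qed.

Fact mop_leUx x y z : mop_le (mop_join x y) z = mop_le x z && mop_le y z.
Proof.
by rewrite mop_leM /mopM /= -orth_galois subUset -/(mopM z) -mopJE.
Qed.

End Graph.

Fact mop_display : Order.disp_t. Proof. exact: (Order.Disp tt tt). Qed.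

HB.instance Definition _ (V : finType) (e : rel V) :=
  Order.Le_isPOrder.Build mop_display (mop e)
    (@mop_le_refl V e) (@mop_le_anti V e) (@mop_le_trans V e).

HB.instance Definition _ (V : finType) (e : rel V) :=
  Order.POrder_MeetJoin_isLattice.Build mop_display (mop e)
    (@mop_lexI V e) (@mop_leUx V e).

Fact mop_le0x (V : finType) (e : rel V) (x : mop e) :
  (mop_of_J e set0 <= x)%O.
Proof.
rewrite -[(_ <= _)%O]/(mop_le _ _) mop_leM /mopM /= -orth_galois.
exact: sub0set.
Qed.

Fact mop_lex1 (V : finType) (e : rel V) (x : mop e) :
  (x <= mop_of_M e set0)%O.
Proof.
by rewrite -[(_ <= _)%O]/(mop_le _ _) /mop_le {2}/mopJ /= orth_galois sub0set.
Qed.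

HB.instance Definition _ (V : finType) (e : rel V) :=
  Order.hasBottom.Build mop_display (mop e) (@mop_le0x V e).
HB.instance Definition _ (V : finType) (e : rel V) :=
  Order.hasTop.Build mop_display (mop e) (@mop_lex1 V e).

Section Trim.
Local Open Scope order_scope.
Variables (d : Order.disp_t) (L : finTBLatticeType d).
Implicit Types (x y z : L) (C : {set L}).

Definition covered x y : bool := (x < y) && [forall z, ~~ (x < z < y)].

Definition join_irreducible x : bool :=
  (x != \bot) && [forall y, forall z, (x == y `|` z) ==> ((x == y) || (x == z))].

Definition meet_irreducible x : bool :=
  (x != \top) && [forall y, forall z, (x == y `&` z) ==> ((x == y) || (x == z))].

Definition chain C : bool := [forall x in C, forall y in C, x >=< y].

(* A chain of length r has r + 1 elements. *)
Definition lattice_length : nat := \max_(C : {set L} | chain C) #|C|.-1.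

Definition extremal : bool :=
  (lattice_length == #|[set x | join_irreducible x]|) &&
  (lattice_length == #|[set x | meet_irreducible x]|).

Definition left_modular x : bool :=
  [forall y, forall z, (y <= z) ==> ((y `|` x) `&` z == y `|` (x `&` z))].

Definition left_modular_lattice : bool :=
  [exists C : {set L}, maxset chain C && [forall x in C, left_modular x]].

Definition trim : bool := extremal && left_modular_lattice.

End Trim.

Arguments trim {d} L.

(* When x is covered by y, the label of the cover is the element g for which
   mopM x :&: mopJ y is the singleton [set g]. *)
Definition Dlabels (V : finType) (e : rel V) (y : mop e) : {set V} :=
  [set g | [exists x : mop e, covered x y && (mopM x :&: mopJ y == [set g])]].

Definition Ulabels (V : finType) (e : rel V) (y : mop e) : {set V} :=
  [set g | [exists z : mop e, covered y z && (mopM y :&: mopJ z == [set g])]].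

Definition is_lub (T : Type) (le : rel T) (x y z : T) : Prop :=
  forall w, le z w = le x w && le y w.

Definition is_glb (T : Type) (le : rel T) (x y z : T) : Prop :=
  forall w, le w z = le w x && le w y.

Definition is_lattice (T : Type) (le : rel T) : Prop :=
  [/\ reflexive le, antisymmetric le, transitive le,
      forall x y, exists z, is_lub le x y z
    & forall x y, exists z, is_glb le x y z].

(* Main.v *)
Require Import Defs.
From mathcomp Require Import all_boot all_order.

Set Implicit Arguments.
Unset Strict Implicit.
Unset Printing Implicit Defensive.

Import Order.TTheory.

(** Everything is reduced to one condition on the lattice of maximal orthogonal
pairs, called [overlapping] below: whenever x < y, the sets x_M and y_J meet.

Trim is equivalent to overlapping.  The lattice is always extremal, because the
initial segments of a linear extension form a chain of length #|V| while the
join-irreducibles are exactly the elements generated by one vertex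
([mop_extremal]).  A left modular x has x_J and x_M complementary, so two
consecutive members of a maximal left modular chain differ by one vertex s, and
the interval x < y is crossed at some such s, which then lies in both x_M and
y_J ([left_modular_overlapping]).  Conversely, if the modular law failed for a
down-closed set, a vertex in the overlap of the two sides could lie neither
inside nor outside that set ([overlapping_left_modular]).

In an overlapping lattice every cover has exactly one label, and x is both the
join of the vertices of D(x) and the meet of those of U(x).  The one delicate
point is that D(x) is independent ([lower_cover_edge_free]): an edge between
two labels would generate an infinite ascending sequence of vertices.  Since an
independent set D can be recovered from its right orthogonal, sending (D, U) to
the join of D inverts phi; and since a flip is characterised by the vertices
on which it cannot change D and U ([flip_at]), covers correspond to flips.

For the converse implication let top(G) be a lattice, let j_g be the top with
D = {g} and m_g the top with U = {g}.  In any graph, j_g <= (D, U) as soon as g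
is orthogonal to U, and dually for m_g ([join_gen_le], [meet_gen_le]).  In the
lattice j_g <= m_g is impossible ([j_nle_m]); hence every top is the join of
the j_d with d in D, from which j_g <= m_k holds exactly when g and k are
orthogonal ([j_le_m]).  Sending x to the join of the j_g with g in x_J then
embeds the maximal orthogonal pairs in top(G), and the first flip on a path
from the image of x to the image of y gives a vertex of x_M that lies in y_J. *)

(** * Reflexive-transitive closures, edge reversal and orthogonality *)

Lemma connect_homo (T T' : finType) (R : rel T) (R' : rel T') (f : T -> T') :
  (forall x y, R x y -> connect R' (f x) (f y)) ->
  forall x y, connect R x y -> connect R' (f x) (f y).
Proof.
move=> fR x _ /connectP[s sP ->].
elim: s x sP => //= y s IHs x /andP[/fR xy /IHs]; exact: connect_trans.
Qed.

Lemma connect_last (T : finType) (R : rel T) x y :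
  connect R x y -> x != y -> exists2 z, connect R x z & R z y.
Proof.
move=> /connectP[s]; case/lastP: s => [_ -> /=|s z]; first by rewrite eqxx.
rewrite rcons_path last_rcons => /andP[sP zP -> _].
by exists (last x s) => //; apply/connectP; exists s.
Qed.

Lemma connect_first (T : finType) (R : rel T) x y :
  connect R x y -> x != y -> exists2 z, R x z & connect R z y.
Proof.
move=> /connectP[[|z s] /= sP ->]; first by rewrite eqxx.
by case/andP: sP => xz sP _; exists z => //; apply/connectP; exists s.
Qed.

(** Reversing all edges exchanges D with U, x_J with x_M, and both orders with
their opposites, which carries facts about one side over to the other. *)
Definition rev_edge (V : finType) (e : rel V) : rel V := fun x y => e y x.

Lemma gge_rev (V : finType) (e : rel V) x y : gge (rev_edge e) x y = gge e y x.
Proof. exact: (connect_rev e x y). Qed.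

Lemma rev_linear_extension (V : finType) (e : rel V) s :
  linear_extension e s -> reverse_linear_extension (rev_edge e) s.
Proof. by case=> ? h; split=> // x y /h. Qed.

Lemma rev_reverse_linear_extension (V : finType) (e : rel V) s :
  reverse_linear_extension e s -> linear_extension (rev_edge e) s.
Proof. by case=> ? h; split=> // x y /h. Qed.

Section Orthogonality.
Variables (V : finType) (e : rel V).
Implicit Types (A D U X Y : {set V}) (g h k x y : V).

(** The reflexive closure of the edge relation: disjointness and absence of
edges together say that no element of X hits an element of Y. *)
Definition hits x y := (x == y) || e x y.

Lemma hitsxx x : hits x x. Proof. by rewrite /hits eqxx. Qed.

Lemma orthrPn X y : reflect (exists2 x, x \in X & hits x y) (y \notin orthr e X).
Proof.
rewrite inE; apply: (iffP forall_inPn) => -[x xX xy]; exists x => //.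
  by move: xy; rewrite /= -negb_or negbK.
by rewrite /= -negb_or negbK.
Qed.

Lemma orthlPn Y x : reflect (exists2 y, y \in Y & hits x y) (x \notin orthl e Y).
Proof.
rewrite inE; apply: (iffP forall_inPn) => -[y yY xy]; exists y => //.
  by move: xy; rewrite /= -negb_or negbK.
by rewrite /= -negb_or negbK.
Qed.

Lemma orthrP X y :
  reflect (forall x, x \in X -> ~~ hits x y) (y \in orthr e X).
Proof.
apply: (iffP idP) => [yX x xX|yX].
  by apply: contraTN yX => xy; apply/orthrPn; exists x.
by rewrite -[_ \in _]negbK; apply/negP => /orthrPn[x /yX/negP].
Qed.

Lemma orthlP Y x :
  reflect (forall y, y \in Y -> ~~ hits x y) (x \in orthl e Y).
Proof.
apply: (iffP idP) => [xY y yY|xY].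
  by apply: contraTN xY => xy; apply/orthlPn; exists y.
by rewrite -[_ \in _]negbK; apply/negP => /orthlPn[y /xY/negP].
Qed.

Lemma orthrU X X' : orthr e (X :|: X') = orthr e X :&: orthr e X'.
Proof.
apply/setP => y; rewrite in_setI; apply/orthrP/andP => [h|[/orthrP h /orthrP h'] x].
  by split; apply/orthrP => x xX; apply: h; rewrite inE xX ?orbT.
by case/setUP; [apply: h | apply: h'].
Qed.

Lemma orthlU X X' : orthl e (X :|: X') = orthl e X :&: orthl e X'.
Proof.
apply/setP => y; rewrite in_setI; apply/orthlP/andP => [h|[/orthlP h /orthlP h'] x].
  by split; apply/orthlP => x xX; apply: h; rewrite inE xX ?orbT.
by case/setUP; [apply: h | apply: h'].
Qed.

Lemma in_orthr1 g y : (y \in orthr e [set g]) = ~~ hits g y.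
Proof.
by apply/orthrP/idP => [|h x /set1P-> //]; apply; rewrite inE.
Qed.

Lemma in_orthl1 g y : (y \in orthl e [set g]) = ~~ hits y g.
Proof.
by apply/orthlP/idP => [|h x /set1P-> //]; apply; rewrite inE.
Qed.

Lemma independentP D :
  reflect (forall x y, x \in D -> y \in D -> ~~ e x y) (independent e D).
Proof.
apply: (iffP 'forall_in_forall_inP) => h x; first by move=> y xD; apply: h.
by move=> xD y; apply: h.
Qed.

End Orthogonality.

Arguments orthrPn {V e X y}.
Arguments orthlPn {V e Y x}.
Arguments orthrP {V e X y}.
Arguments orthlP {V e Y x}.

Lemma hits_rev (V : finType) (e : rel V) x y :
  hits (rev_edge e) x y = hits e y x.
Proof. by rewrite /hits eq_sym. Qed.

Lemma orthr_rev (V : finType) (e : rel V) X : orthr (rev_edge e) X = orthl e X.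
Proof.
by apply/setP => y; apply/orthrP/orthlP => h x /h; rewrite hits_rev.
Qed.

Lemma orthl_rev (V : finType) (e : rel V) X : orthl (rev_edge e) X = orthr e X.
Proof.
by apply/setP => y; apply/orthlP/orthrP => h x /h; rewrite hits_rev.
Qed.

Lemma independent_rev (V : finType) (e : rel V) D :
  independent (rev_edge e) D = independent e D.
Proof. by apply/independentP/independentP => h x y xD yD; apply: h. Qed.

(** * Consequences of a linear extension *)

Section Extension.
Variables (V : finType) (e : rel V) (l : seq V).
Hypothesis lin_l : linear_extension e l.
Implicit Types (D U X Y : {set V}) (g h k x y : V).

Lemma edge_index x y : e x y -> index y l < index x l.
Proof. by case: lin_l => _; apply. Qed.

Lemma index_ext_inj : injective (index^~ l).
Proof.
have ml x : x \in l by rewrite (perm_mem (proj1 lin_l)) mem_enum.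
by move=> x y /index_inj; apply.
Qed.

Lemma edge_irr x : e x x = false.
Proof. by apply/negP => /edge_index; rewrite ltnn. Qed.

Lemma edge_asym x y : e x y -> e y x -> False.
Proof. by move=> /edge_index xy /edge_index /(ltn_trans xy); rewrite ltnn. Qed.

Lemma gge_index x y : gge e x y -> index y l <= index x l.
Proof.
move=> /connectP[s sP ->] {y}; elim: s x sP => //= y s IHs x /andP[xy /IHs].
by move=> h; apply: (leq_trans h); apply/ltnW/edge_index.
Qed.

Lemma gge_anti x y : gge e x y -> gge e y x -> x = y.
Proof.
move=> /gge_index xy /gge_index yx; apply: index_ext_inj; apply/eqP.
by rewrite eqn_leq xy yx.
Qed.

(** Well-founded induction from the sources downwards, with the position in the
linear extension as the measure. *)
Lemma source_ind (P : V -> Prop) :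
  (forall k, (forall h, e h k -> P h) -> P k) -> forall k, P k.
Proof.
move=> IH k; have [n] := ubnP (size l - index k l).
elim: n k => // n IHn k kn; apply: IH => h hk; apply: IHn.
have lt_hk := edge_index hk; rewrite -ltnS; apply: leq_trans kn.
rewrite ltnS ltn_sub2l //.
apply: leq_trans lt_hk _; exact: index_size.
Qed.

(** If k is in D but not in E, some other h in E hits k, that is h -> k; by
induction h is in D as well, and D is not independent. *)
Lemma orthr_inj D E : independent e D -> independent e E ->
  orthr e D = orthr e E -> D = E.
Proof.
move=> /independentP iD /independentP iE eDE; apply/setP => k.
elim/source_ind: k => k IH; apply/idP/idP => kD.
  have: k \notin orthr e E by rewrite -eDE; apply/orthrPn; exists k; rewrite ?hitsxx.
  case/orthrPn => h hE /predU1P[<- //|hk].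
  by have := iD h k; rewrite IH // hk => /(_ hE kD).
have: k \notin orthr e D by rewrite eDE; apply/orthrPn; exists k; rewrite ?hitsxx.
case/orthrPn => h hE /predU1P[<- //|hk].
by have := iE h k; rewrite -IH // hk => /(_ hE kD).
Qed.

End Extension.

(** * Tops and flips *)

(** Tightness without exchange operations: no vertex is orthogonal both to U
and to D.  Equivalently each vertex outside D and U receives an edge from D or
sends one to U. *)
Definition is_top (V : finType) (e : rel V) (p : {set V} * {set V}) : bool :=
  [&& independent e p.1, independent e p.2, p.1 \subset orthl e p.2
    & [disjoint orthl e p.2 & orthr e p.1]].

(** A flip at g can only change D below g and U above g, and these conditions
determine q from p; this description involves no choice of linear extensions
and is symmetric under edge reversal. *)
Definition flip_at (V : finType) (e : rel V) (g : V) (p q : {set V} * {set V}) :=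
  [/\ g \in p.2, g \in q.1,
      forall k, ~~ gge e g k -> (k \in p.1) = (k \in q.1)
    & forall k, ~~ gge e k g -> (k \in p.2) = (k \in q.2)].

Definition flip_atb (V : finType) (e : rel V) (g : V) (p q : {set V} * {set V}) :=
  [&& g \in p.2, g \in q.1,
      [forall k, ~~ gge e g k ==> ((k \in p.1) == (k \in q.1))]
    & [forall k, ~~ gge e k g ==> ((k \in p.2) == (k \in q.2))]].

Lemma flip_atP V e g p q : reflect (@flip_at V e g p q) (flip_atb e g p q).
Proof.
apply: (iffP and4P) => -[gp gq h1 h2]; split=> //.
- by move=> k kg; apply/eqP; move: k kg; apply/'forall_implyP.
- by move=> k kg; apply/eqP; move: k kg; apply/'forall_implyP.
- by apply/'forall_implyP => k kg; rewrite h1.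
- by apply/'forall_implyP => k kg; rewrite h2.
Qed.

Definition flip_rel (V : finType) (e : rel V) : rel ({set V} * {set V}) :=
  fun p q => [&& is_top e p, is_top e q & [exists g, flip_atb e g p q]].

Lemma flip_relP V e p q :
  reflect [/\ is_top e p, is_top e q & exists g, flip_at e g p q]
          (@flip_rel V e p q).
Proof.
apply: (iffP and3P) => -[tp tq].
  by case/existsP=> g /flip_atP h; split=> //; exists g.
by case=> g /flip_atP h; split=> //; apply/existsP; exists g.
Qed.

Definition swap (T : Type) (p : T * T) := (p.2, p.1).

Lemma is_top_rev (V : finType) (e : rel V) p :
  is_top (rev_edge e) (swap p) = is_top e p.
Proof.
rewrite /is_top /= !(independent_rev e) (orthl_rev e) (orthr_rev e).
rewrite -[p.2 \subset _]orth_galois.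
by rewrite [in LHS]disjoint_sym andbCA.
Qed.

Lemma flip_at_rev (V : finType) (e : rel V) g p q :
  flip_at (rev_edge e) g (swap q) (swap p) <-> flip_at e g p q.
Proof.
rewrite /flip_at /=; split=> -[h1 h2 h3 h4]; split=> // k.
- by move=> kg; rewrite h4 // gge_rev.
- by move=> kg; rewrite h3 // gge_rev.
- by rewrite gge_rev => /h4.
- by rewrite gge_rev => /h3.
Qed.

Section Tops.
Variables (V : finType) (e : rel V) (l l' : seq V).
Hypothesis lin_l : linear_extension e l.
Hypothesis revlin_l' : reverse_linear_extension e l'.
Implicit Types (A B C D U X Y : {set V}) (p q : {set V} * {set V}).
Implicit Types (g h k x y : V) (s : seq V).

(** Given k orthogonal to both D and U, let S be the set of elements of D that
receive an edge from k: replacing S by k increases D, or adds k to D when S is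
empty.  Conversely an element g that could be inserted would be blocked by an
edge from D or to U, which is incompatible with acyclicity. *)
Lemma tightE p : tight e p = is_top e p.
Proof.
have irr := edge_irr lin_l.
case: p => D U; rewrite /tight /is_top /orth_indep /=.
rewrite orthogonal_sub_orthl; case: (boolP (independent e D)) => //= iD.
case: (boolP (independent e U)) => //= iU; case: (boolP (D \subset _)) => //= sDU.
move/independentP: (iD) => nD; move/independentP: (iU) => nU.
have sUD : U \subset orthr e D by rewrite -orth_galois.
apply/idP/idP => [/and4P[h1 h2 h3 h4]|dDU].
  rewrite -setI_eq0; apply/eqP/setP => k; rewrite in_set0; apply/negP.
  case/setIP=> /orthlP kU /orthrP Dk.
  have kD : k \notin D by apply/negP => /Dk; rewrite hitsxx.
  have sD (S : {set V}) : k |: (D :\: S) \subset orthl e U.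
    rewrite subUset sub1set; apply/andP; split; first exact/orthlP.
    exact: subset_trans (subsetDl _ _) sDU.
  pose S := [set d in D | e k d].
  have iS : independent e (k |: (D :\: S)).
    apply/independentP => x y; rewrite !inE.
    case/predU1P=> [->|/andP[xS xD]]; case/predU1P => [->|/andP[yS yD]].
    - by rewrite irr.
    - by move: yS; rewrite yD.
    - by have := Dk x xD; rewrite negb_or => /andP[].
    - exact: nD.
  have [S0|S0] := eqVneq S set0.
    case/existsP: h3; exists k; rewrite kD /orth_indep iU orthogonal_sub_orthl.
    by have := sD S; move: iS; rewrite S0 setD0 => -> ->.
  case/existsP: h1; exists S; apply/existsP; exists k; rewrite S0 kD.
  rewrite /orth_indep iU iS orthogonal_sub_orthl sD // !andbT.
  apply/andP; split; first by apply/subsetP => x; rewrite inE => /andP[].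
  apply/forall_inP => d; rewrite inE => /andP[_ kd].
  by rewrite /ggt /gge connect1 // andbT; apply: contraTneq kd => ->; rewrite irr.
have noD k : k \in orthl e U -> exists2 d, d \in D & hits e d k.
  by move=> kU; apply/orthrPn; rewrite (disjointFr dDU).
have noU k : k \in orthr e D -> exists2 u, u \in U & hits e k u.
  by move=> kD; apply/orthlPn; rewrite (disjointFl dDU).
have asym x y : ggt e x y -> e y x -> False.
  case/andP=> /eqP xy gxy yx; apply: xy; apply: (gge_anti lin_l) => //.
  exact: connect1.
apply/and4P; split.
- apply/existsP => -[S /existsP[g /and5P[/subsetP SD S0 gD /forall_inP Sg]]].
  rewrite /orth_indep orthogonal_sub_orthl => /and3P[/independentP iS _ /subsetP sS].
  case: (noD g); first by apply: sS; rewrite setU11.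
  move=> d dD /predU1P[dg|dg]; first by rewrite -dg dD in gD.
  have [dS|dS] := boolP (d \in S); first exact: (asym _ _ (Sg d dS)).
  by have := iS d g; rewrite !inE eqxx dS dD orbT dg => /(_ isT isT).
- apply/existsP => -[S /existsP[g /and5P[/subsetP SU S0 gU /forall_inP Sg]]].
  rewrite /orth_indep orthogonal_sub_orthr => /and3P[_ /independentP iS /subsetP sS].
  case: (noU g); first by apply: sS; rewrite setU11.
  move=> u uU /predU1P[ug|gu]; first by rewrite ug uU in gU.
  have [uS|uS] := boolP (u \in S); first exact: (asym _ _ (Sg u uS)).
  by have := iS g u; rewrite !inE eqxx uS uU orbT gu => /(_ isT isT).
- apply/existsP => -[g /andP[gD]].
  rewrite /orth_indep orthogonal_sub_orthl => /and3P[/independentP iS _ /subsetP sS].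
  case: (noD g); first by apply: sS; rewrite setU11.
  move=> d dD /predU1P[dg|dg]; first by rewrite -dg dD in gD.
  by have := iS d g; rewrite !inE eqxx dD orbT dg => /(_ isT isT).
- apply/existsP => -[g /andP[gU]].
  rewrite /orth_indep orthogonal_sub_orthr => /and3P[_ /independentP iS /subsetP sS].
  case: (noU g); first by apply: sS; rewrite setU11.
  move=> u uU /predU1P[ug|gu]; first by rewrite ug uU in gU.
  by have := iS g u; rewrite !inE eqxx uU orbT gu => /(_ isT isT).
Qed.

(** Membership of k in D depends on U and on the part of D above k, which makes
D a function of U. *)
Lemma top_mem1 p k : is_top e p ->
  (k \in p.1) = (k \in orthl e p.2) && [forall d in p.1, ~~ e d k].
Proof.
case: p => D U /and4P[/= /independentP iD _ /subsetP sDU dDU].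
apply/idP/andP => [kD|[kU /forall_inP nDk]].
  by split; [exact: sDU | apply/forall_inP => d dD; apply: iD].
have /orthrPn[d dD] : k \notin orthr e D by rewrite (disjointFr dDU).
by case/predU1P=> [<- //|dk]; have := nDk d dD; rewrite dk.
Qed.

(** This fixpoint equation for C refers only to the elements of C above k. *)
Lemma kernel_unique (P Q : pred V) C C' :
  (forall k, k \in C = Q k || (P k && [forall d in C, ~~ e d k])) ->
  (forall k, k \in C' = Q k || (P k && [forall d in C', ~~ e d k])) -> C = C'.
Proof.
move=> hC hC'; apply/setP => k; elim/(source_ind lin_l): k => k IH.
rewrite hC hC'; congr (_ || (_ && _)); apply: eq_forallb => d.
by case: (boolP (e d k)) => [/IH->|_] //; rewrite !implybT.
Qed.

Lemma top_eq2 p q : is_top e p -> is_top e q -> p.2 = q.2 -> p = q.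
Proof.
move=> tp tq epq; rewrite [p]surjective_pairing [q]surjective_pairing -epq.
congr (_, _); apply: (@kernel_unique (mem (orthl e p.2)) pred0) => k /=.
  exact: top_mem1.
by rewrite epq; apply: top_mem1.
Qed.

(** Along a list in which edges point forward, testing k against the set built
so far is the same as testing k against the final set: elements added later
have no edge to k. *)
Lemma greedyE s (a b : pred V) C0 k :
  pairwise (fun x y => ~~ e y x) s ->
  let C := foldl (fun C x =>
    if [&& a x, b x & [forall d in C, ~~ e d x]] then x |: C else C) C0 s in
  (k \in C) = (k \in C0) ||
    ([&& k \in s, a k & b k] && [forall d in C, ~~ e d k]).
Proof.
elim: s C0 k => [|x s IHs] C0 k /=; first by rewrite orbF.
case/andP=> /allP xs /IHs {}IHs.
set C1 := if _ then _ else _; set C := foldl _ _ _.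
have {}IHs m : (m \in C) = _ := IHs C1 m.
have noC : [forall d in C, ~~ e d x] = [forall d in C0, ~~ e d x].
  have sC1 : C0 \subset C1 by rewrite /C1; case: ifP => // _; apply: subsetUr.
  apply/forall_inP/forall_inP => h d dC.
    by apply: h; rewrite IHs (subsetP sC1).
  move: dC; rewrite IHs => /orP[|/andP[/and3P[/xs //]]].
  rewrite /C1; case: ifP => _; last exact: h.
  by case/setU1P=> [->|/h //]; rewrite (edge_irr lin_l).
have -> : (k \in C) = (k \in C1) || _ := IHs k.
have -> : (k \in C1) =
    (k \in C0) || [&& k == x, a x, b x & [forall d in C, ~~ e d x]].
  by rewrite noC /C1; case: ifP; rewrite ?inE ?andbT ?andbF ?orbF 1?orbC.
rewrite inE; have [->|_] /= := eqVneq k x; last by rewrite orbF.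
by case: (a x); case: (b x); case: [forall d in C, _]; rewrite ?andbF ?orbF ?orbT.
Qed.

Lemma revlin_pairwise : pairwise (fun x y => ~~ e y x) l'.
Proof.
case: l' revlin_l' => // x0 s [pl' h].
have ul' : uniq (x0 :: s) by rewrite (perm_uniq pl') enum_uniq.
apply/(pairwiseP x0) => i j; rewrite !inE => il jl ij; apply/negP => /h.
by rewrite !index_uniq // ltnNge ltnW.
Qed.

Lemma kernel_exists (P Q : pred V) : exists C : {set V}, forall k,
  (k \in C) = Q k || (P k && [forall d in C, ~~ e d k]).
Proof.
exists (foldl (fun (C : {set V}) x =>
  if [&& P x, true & [forall d in C, ~~ e d x]] then x |: C else C)
  [set k | Q k] l') => k.
rewrite (greedyE P xpredT [set k | Q k] k revlin_pairwise) inE.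
by rewrite (perm_mem (proj1 revlin_l')) mem_enum andbT.
Qed.

End Tops.

Section Flips.
Variables (V : finType) (e : rel V) (l l' : seq V).
Hypothesis lin_l : linear_extension e l.
Hypothesis revlin_l' : reverse_linear_extension e l'.
Implicit Types (A B C D U X Y : {set V}) (p q : {set V} * {set V}).
Implicit Types (g h k x y : V) (s : seq V).

Let rlin := rev_reverse_linear_extension revlin_l'.
Let rrevlin := rev_linear_extension lin_l.

Lemma top_mem2 p k : is_top e p ->
  (k \in p.2) = (k \in orthr e p.1) && [forall u in p.2, ~~ e k u].
Proof. by rewrite -(is_top_rev e) => /(top_mem1 k)/=; rewrite (orthl_rev e). Qed.

Lemma top_eq1 p q : is_top e p -> is_top e q -> p.1 = q.1 -> p = q.
Proof.
rewrite -!(is_top_rev e) => tp tq epq.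
by have [] := top_eq2 rlin tp tq epq; case: p q {tp tq epq} => [? ?] [? ?] /= -> ->.
Qed.

Lemma top_disjoint p k : is_top e p -> k \in p.1 -> k \in p.2 -> False.
Proof.
case/and4P=> _ _ /subsetP s _ /s /orthlP h /h; by rewrite hitsxx.
Qed.

Lemma top_no_hit p d u : is_top e p -> d \in p.1 -> u \in p.2 -> ~~ hits e d u.
Proof. by case/and4P=> _ _ /subsetP s _ /s /orthlP; apply. Qed.

Lemma top_ind1 p x y : is_top e p -> x \in p.1 -> y \in p.1 -> ~~ e x y.
Proof. by case/and4P=> /independentP h _ _ _; apply: h. Qed.

Lemma top_ind2 p x y : is_top e p -> x \in p.2 -> y \in p.2 -> ~~ e x y.
Proof. by case/and4P=> _ /independentP h _ _; apply: h. Qed.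

Lemma top_blocked p k : is_top e p -> k \in orthl e p.2 -> k \notin orthr e p.1.
Proof. by case/and4P=> _ _ _ d kU; rewrite (disjointFr d). Qed.

Lemma gge_trans y x z : gge e x y -> gge e y z -> gge e x z.
Proof. exact: connect_trans. Qed.

Lemma hits_gge x y : hits e x y -> gge e x y.
Proof. by case/predU1P=> [->|/connect1//]; apply: connect0. Qed.

(** The conditions of [flip_at] fix D on the vertices that are not below g and
U on those that are not above g.  The rest of D is filled greedily subject to
the part U0 of U which is kept, and then the rest of U subject to the new D. *)
Lemma flip_exists g p : is_top e p -> g \in p.2 ->
  exists2 q, is_top e q & flip_at e g p q.
Proof.
case: p => D U tp gU; have irr := edge_irr lin_l; rewrite /= in gU.
pose U0 := [set u in U | ~~ gge e u g].
have [D' D'E] := kernel_exists lin_l revlin_l' [pred k | gge e g k && (k \in orthl e U0)]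
  [pred k | ~~ gge e g k && (k \in D)].
have [U' U'E] := kernel_exists rlin rrevlin [pred k | gge e k g && (k \in orthr e D')]
  [pred k | ~~ gge e k g && (k \in U)].
rewrite /= in D'E U'E.
have D'n k : ~~ gge e g k -> (k \in D') = (k \in D).
  by move=> kg; rewrite D'E kg (negPf kg) orbF.
have U'n k : ~~ gge e k g -> (k \in U') = (k \in U).
  by move=> kg; rewrite U'E kg (negPf kg) orbF.
have D'y k : gge e g k -> (k \in D') = (k \in orthl e U0) && [forall d in D', ~~ e d k].
  by move=> kg; rewrite D'E kg.
have U'y k : gge e k g -> (k \in U') = (k \in orthr e D') && [forall u in U', ~~ e k u].
  by move=> kg; rewrite U'E kg.
have sU0 u : u \in U0 -> u \in U' by rewrite inE => /andP[uU ug]; rewrite U'n.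
exists (D', U'); last first.
  split=> //= [|k kg|k kg]; [|by rewrite D'n|by rewrite U'n].
  rewrite D'y; last exact: connect0.
  apply/andP; split; [apply/orthlP|apply/forall_inP] => u.
    rewrite inE negb_or => /andP[uU ug]; rewrite (top_ind2 tp) // andbT.
    by apply: contraNneq ug => ->; apply: connect0.
  have [gu uD'|gu] := boolP (gge e g u).
    by apply/negP => ug; move: (ug); rewrite (gge_anti lin_l gu (connect1 ug)) irr.
  by rewrite D'n // => uD; have := top_no_hit tp uD gU; rewrite negb_or => /andP[].
apply/and4P; split=> /=.
- apply/independentP => a b aD bD; have [gb|gb] := boolP (gge e g b).
    by move: bD; rewrite D'y // => /andP[_ /forall_inP]; apply.
  apply/negP => ab; have ga : ~~ gge e g a.
    by apply: contraNN gb => ga; apply: gge_trans ga (connect1 ab).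
  by have := top_ind1 tp (x := a) (y := b); rewrite ab -!D'n // => /(_ aD bD).
- apply/independentP => a b aU bU; have [ga|ga] := boolP (gge e a g).
    by move: aU; rewrite U'y // => /andP[_ /forall_inP]; apply.
  apply/negP => ab; have gb : ~~ gge e b g.
    by apply: contraNN ga => gb; apply: gge_trans (connect1 ab) gb.
  by have := top_ind2 tp (x := a) (y := b); rewrite ab -!U'n // => /(_ aU bU).
- apply/subsetP => d dD; apply/orthlP => u uU; have [gu|gu] := boolP (gge e u g).
    by move: uU; rewrite U'y // => /andP[/orthrP h _]; apply: h.
  rewrite U'n // in uU; have [gd|gd] := boolP (gge e g d).
    by move: dD; rewrite D'y // => /andP[/orthlP h _]; apply: h; rewrite inE uU.
  by apply: (top_no_hit tp) => //=; rewrite -D'n.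
rewrite disjoint_subset; apply/subsetP => k kU; apply/negP => /= kD.
have nkU u : u \in U' -> ~~ hits e k u by move/orthlP: kU; apply.
have nDk d : d \in D' -> ~~ hits e d k by move/orthrP: kD; apply.
have edgeN x y : ~~ hits e x y -> ~~ e x y by rewrite negb_or => /andP[].
have [kg|kg] := boolP (gge e k g).
  have /nkU/negP : k \in U'.
    by rewrite U'y // kD; apply/forall_inP => u /nkU/edgeN.
  by rewrite hitsxx.
have [gk|gk] := boolP (gge e g k).
  have /nDk/negP : k \in D'.
    rewrite D'y //; apply/andP; split; first by apply/orthlP => u /sU0/nkU.
    by apply/forall_inP => d /nDk/edgeN.
  by rewrite hitsxx.
suff /(top_blocked tp)/orthrPn[d /= dD dk] : k \in orthl e (D, U).2.
  have gd : ~~ gge e g d.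
    by apply: contraNN gk => gd; apply: gge_trans gd (hits_gge dk).
  by move: dk; apply/negP/nDk; rewrite D'n.
apply/orthlP => u /= uU; apply/negP => ku.
have ug : ~~ gge e u g.
  by apply: contraNN kg => ug; apply: gge_trans (hits_gge ku) ug.
by move: ku; apply/negP/nkU; rewrite U'n.
Qed.

(** Both components of q satisfy the fixpoint equation of the greedy passes.
The first pass also tests vertices incomparable to g, but admits none outside
D(q): such a vertex has no edge to a vertex above g, so if it passes the test
against U0 it is orthogonal to all of U(q).  The second pass is symmetric. *)
Lemma flip_eq g p q : is_top e p -> is_top e q -> flip_at e g p q ->
  flip e l l' g p = q.
Proof.
case: p q => [D U] [D' U'] tp tq [/= gU gD' eD eU].
have gD : g \notin D by apply/negP => /(top_disjoint tp); apply.
rewrite /flip inE gU (negPf gD) orbT /= setU0.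
set D0 := _ :|: _; set U0 := [set k in U | _].
set E := foldl _ D0 _.
have mem_l x : x \in l by rewrite (perm_mem (proj1 lin_l)) mem_enum.
have mem_l' x : x \in l' by rewrite (perm_mem (proj1 revlin_l')) mem_enum.
have ED : E = D'.
  apply: (@kernel_unique _ e l lin_l
    [pred k | [&& ~~ gge e k g, k \notin U0 & [forall u in U0, ~~ e k u]]]
    (mem D0)) => k /=.
    rewrite /E (greedyE lin_l (fun k => k \notin U0) (fun k => [forall u in U0, ~~ e k u])
      D0 k (pairwise_filter (fun k => ~~ gge e k g) (revlin_pairwise revlin_l'))).
    by rewrite mem_filter mem_l' andbT.
  have D0n : k \in D0 = (k == g) || (k \in D') && ~~ gge e g k.
    rewrite !inE orbC; congr (_ || _); case: (boolP (gge e g k)) => kg; rewrite ?andbF //.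
    by rewrite -eD.
  have sU0 u : u \in U0 = (u \in U') && ~~ gge e u g.
    by rewrite inE; case: (boolP (gge e u g)) => ug; rewrite ?andbF // -eU.
  rewrite D0n; have [->|kg] := eqVneq k g => //=.
  apply/idP/orP => [kD'|].
    have [gk|gk] := boolP (gge e g k); last by left; rewrite kD'.
    right; have no u : u \in U0 -> ~~ hits e k u.
      by rewrite sU0 => /andP[uU' _]; apply: (top_no_hit tq).
    have ->: ~~ gge e k g by apply: contraNN kg => /(gge_anti lin_l gk)->.
    have -> /= : k \notin U0 by apply/negP => /no; rewrite hitsxx.
    apply/andP; split; apply/forall_inP => u; last by move/(top_ind1 tq); apply.
    by move/no; rewrite negb_or => /andP[].
  case=> [/andP[] //|/andP[/and3P[kg' kU0 /forall_inP nkU0] nDk]].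
  rewrite (top_mem1 k tq) nDk andbT; apply/orthlP => u /= uU'.
  have [ug|ug] := boolP (gge e u g).
    by apply: contraNN kg' => /hits_gge/gge_trans; apply.
  have uU0 : u \in U0 by rewrite sU0 uU'.
  by rewrite negb_or nkU0 // andbT; apply: contraNneq kU0 => ->.
rewrite ED; congr (_, _).
apply: (@kernel_unique _ (rev_edge e) l' rlin
  [pred k | [&& ~~ gge e g k, k \notin D' & [forall d in D', ~~ e d k]]]
  (mem U0)) => k /=.
  rewrite (greedyE rlin (fun k => k \notin D') (fun k => [forall d in D', ~~ e d k])
    U0 k (pairwise_filter (fun k => ~~ gge e g k) (revlin_pairwise rrevlin))).
  by rewrite mem_filter mem_l andbT.
have sU0 u : u \in U0 = (u \in U') && ~~ gge e u g.
  by rewrite inE; case: (boolP (gge e u g)) => ug; rewrite ?andbF // -eU.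
rewrite sU0; apply/idP/orP => [kU'|[/andP[] //|]].
  have [kg|kg] := boolP (gge e k g); last by left; rewrite kU'.
  right; have no d : d \in D' -> ~~ hits e d k.
    by move=> dD'; apply: (top_no_hit tq).
  have kD' : k \notin D' by apply/negP => /no; rewrite hitsxx.
  have -> : ~~ gge e g k.
    by apply: contraNN kD' => /(gge_anti lin_l kg) ->.
  rewrite kD' /=; apply/andP; split; apply/forall_inP => u.
    by move/no; rewrite negb_or => /andP[].
  by move=> uU'; apply: (top_ind2 tq).
case/andP=> [/and3P[gk kD' /forall_inP nD'k]] nkU'.
rewrite (top_mem2 k tq) nkU' andbT; apply/orthrP => d /= dD'.
by rewrite negb_or nD'k // andbT; apply: contraNneq kD' => <-.
Qed.

Lemma flip_upE (t t' : tops e) :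
  flip_up l l' t t' = flip_rel e (val t) (val t').
Proof.
have tt (u : tops e) : is_top e (val u) by rewrite -(tightE lin_l) (valP u).
apply/exists_inP/flip_relP => [[g gU /eqP ft']|[_ _ [g ft]]].
  have [q tq fq] := flip_exists (tt t) gU.
  by split=> //; exists g; rewrite -ft' (flip_eq (tt t) tq fq).
by exists g; [case: ft | apply/eqP/flip_eq].
Qed.

Lemma top_leE (t t' : tops e) :
  top_le l l' t t' = connect (flip_rel e) (val t) (val t').
Proof.
apply/idP/idP; first by apply: connect_homo => x y; rewrite flip_upE => /connect1.
pose f p : tops e := insubd t p.
have fK (u : tops e) : f (val u) = u by apply: valKd.
rewrite -{2}(fK t) -{2}(fK t'); apply: connect_homo => p q fpq.
apply: connect1; rewrite flip_upE /f !val_insubd; case/flip_relP: (fpq) => tp tq _.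
by rewrite !(tightE lin_l) tp tq.
Qed.
End Flips.

(** * The order on tops *)

Section TopOrder.
Variables (V : finType) (e : rel V) (l l' : seq V).
Hypothesis lin_l : linear_extension e l.
Hypothesis revlin_l' : reverse_linear_extension e l'.
Implicit Types (A B C D U X Y : {set V}) (p q : {set V} * {set V}).
Implicit Types (g h k x y : V) (s : seq V).

Let rlin := rev_reverse_linear_extension revlin_l'.
Let rrevlin := rev_linear_extension lin_l.

Lemma flip_exists_down g q : is_top e q -> g \in q.1 ->
  exists2 p, is_top e p & flip_at e g p q.
Proof.
rewrite -(is_top_rev e) => tq gq.
have [p tp fp] := flip_exists rlin rrevlin tq gq.
by exists (swap p); [rewrite -(is_top_rev e) | apply/flip_at_rev]; case: p tp fp.
Qed.

Lemma top_of_independent D : independent e D -> exists2 p, is_top e p & p.1 = D.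
Proof.
move=> iD; have [U UE] := kernel_exists rlin rrevlin (mem (orthr e D)) pred0.
exists (D, U) => //; rewrite /= in UE; apply/and4P; split=> //=.
- apply/independentP => x y; rewrite [x \in U]UE => /andP[_ /forall_inP h].
  exact: h.
- by rewrite orth_galois; apply/subsetP => u; rewrite UE => /andP[].
rewrite disjoint_subset; apply/subsetP => k /orthlP kU; apply/negP => /= kD.
have /kU : k \in U; last by rewrite hitsxx.
rewrite UE kD; apply/forall_inP => u /kU.
by rewrite negb_or => /andP[].
Qed.

Definition lower A := forall x y, gge e x y -> x \in A -> y \in A.

(** Take the greedy independent sets in A, from its sources, and in the
complement, from its sinks: no edge leads from A to its complement, so the two
sets do not interfere. *)
Lemma lower_top A : lower A -> exists p,
  [/\ is_top e p, p.1 \subset A & p.2 \subset ~: A].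
Proof.
move=> lA; have [D DE] := kernel_exists lin_l revlin_l' (mem A) pred0.
have [U UE] := kernel_exists rlin rrevlin (mem (~: A)) pred0.
rewrite /= in DE UE.
have sD : D \subset A by apply/subsetP => k; rewrite DE => /andP[].
have sU : U \subset ~: A by apply/subsetP => k; rewrite UE => /andP[].
exists (D, U); split=> //; apply/and4P; split=> /=.
- apply/independentP => x y xD; rewrite DE => /andP[_ /forall_inP]; exact.
- apply/independentP => x y; rewrite [x \in U]UE => /andP[_ /forall_inP h].
  exact: h.
- apply/subsetP => d /(subsetP sD) dA; apply/orthlP => u /(subsetP sU).
  by rewrite inE; apply: contra => /hits_gge/lA; apply.
rewrite disjoint_subset; apply/subsetP => k /orthlP kU; apply/negP => /= /orthrP Dk.
have [kA|kA] := boolP (k \in A).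
  have /Dk : k \in D; last by rewrite hitsxx.
  by rewrite DE kA; apply/forall_inP => d /Dk; rewrite negb_or => /andP[].
have /kU : k \in U; last by rewrite hitsxx.
by rewrite UE inE kA; apply/forall_inP => u /kU; rewrite negb_or => /andP[].
Qed.

(** A flip downwards at g in D only inserts vertices below g in D. *)
Lemma connect_lower1 A p q : lower A -> connect (flip_rel e) p q ->
  q.1 \subset A -> p.1 \subset A.
Proof.
move=> lA /connectP[s sP ->] {q}; elim: s p sP => //= q s IHs p.
case/andP=> /flip_relP[_ _ [g [_ gq eD _]]] /IHs {}IHs /IHs/subsetP sA.
apply/subsetP => k kp; have [gk|gk] := boolP (gge e g k).
  exact: lA gk (sA g gq).
by apply: sA; rewrite -eD.
Qed.

Lemma connect_lower2 A p q : lower A -> connect (flip_rel e) p q ->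
  p.2 \subset ~: A -> q.2 \subset ~: A.
Proof.
move=> lA /connectP[s sP ->] {q}; elim: s p sP => //= q s IHs p.
case/andP=> /flip_relP[_ _ [g [gp _ _ eU]]] /IHs {}IHs /subsetP sA.
apply: IHs; apply/subsetP => k kq; have [kg|kg] := boolP (gge e k g).
  by have := sA g gp; rewrite !inE; apply: contra; apply: lA.
by apply: sA; rewrite eU.
Qed.

(** Flip downwards at the element d of D other than g that comes last in the
linear extension, until only g remains.  Such a flip keeps g orthogonal to U.
It changes U only above d, so if d is not below g it does not touch the
vertices that g hits; and if d is below g, then all elements of D other than g
precede g, so that g, which is orthogonal to U, lies in D and stays there. *)
Lemma join_gen_le g p q : is_top e p -> is_top e q -> p.1 = [set g] ->
  g \in orthl e q.2 -> connect (flip_rel e) p q.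
Proof.
move=> tp tq pg; have [n] : exists n, forall k, k \in q.1 -> k != g -> index k l < n.
  by exists (size l).+1 => k _ _; rewrite ltnS index_size.
elim: n q tq => [|n IHn] q tq hq gq.
  have q1 k : k \in q.1 -> k = g.
    by move=> kq; apply/eqP/negPn/negP => /(hq k kq).
  have /orthrPn[d /[dup] dq /q1 dg _] := top_blocked tq gq.
  suff -> : p = q by apply: connect0.
  apply: (top_eq1 revlin_l' tp tq); rewrite pg; apply/setP => k; rewrite inE.
  by apply/eqP/idP => [kg|/q1]; rewrite // kg -dg.
have [/exists_inP[d dq /andP[dg /eqP dn]]|no] :=
  boolP [exists d in q.1, (d != g) && (index d l == n)]; last first.
  apply: IHn => // k kq kg; have := hq k kq kg; rewrite ltnS leq_eqVlt.
  by case/predU1P=> // kn; case/exists_inP: no; exists k => //; rewrite kg kn /=.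
have [r tr frq] := flip_exists_down tq dq; have [dr _ eD eU] := frq.
apply: (@connect_trans _ _ r); last first.
  by apply/connect1/flip_relP; split=> //; exists d.
apply: IHn => // [k kr kg|].
  have kd : k != d by apply/eqP => kd; apply: (top_disjoint tr kr); rewrite kd.
  rewrite ltn_neqAle -{1}dn (inj_eq (index_ext_inj lin_l)) kd /=.
  have [dk|dk] := boolP (gge e d k); first by rewrite -dn (gge_index lin_l).
  by rewrite -ltnS hq // -eD.
apply/orthlP => u ur; have [ud|ud] := boolP (gge e u d); last first.
  by move/orthlP: gq; apply; rewrite -eU.
apply/negP => gu; have gd : gge e g d := gge_trans (hits_gge gu) ud.
have dg' : ~~ gge e d g by apply: contraNN dg => h; rewrite (gge_anti lin_l gd h).
have gq1 : g \in q.1.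
  have /orthrPn[d' d'q /predU1P[<- //|d'g]] := top_blocked tq gq.
  have := gge_index lin_l gd; rewrite dn leqNgt => /negP[].
  apply: leq_trans (edge_index lin_l d'g) _; rewrite -ltnS; apply: hq => //.
  by apply: contraTneq d'g => ->; rewrite (edge_irr lin_l).
have gr : g \in r.1 by rewrite eD.
by have := top_no_hit tr gr ur; rewrite gu.
Qed.

End TopOrder.

Section TopOrderDual.
Variables (V : finType) (e : rel V) (l l' : seq V).
Hypothesis lin_l : linear_extension e l.
Hypothesis revlin_l' : reverse_linear_extension e l'.
Implicit Types (p q : {set V} * {set V}) (g : V).

Lemma meet_gen_le g p q : is_top e p -> is_top e q -> q.2 = [set g] ->
  g \in orthr e p.1 -> connect (flip_rel e) p q.
Proof.
rewrite -!(is_top_rev e) -(orthl_rev e) => tp tq qg gp.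
have := join_gen_le (rev_reverse_linear_extension revlin_l')
  (rev_linear_extension lin_l) tq tp qg gp.
have swapK (x : {set V} * {set V}) : swap (swap x) = x by case: x.
rewrite -[connect (flip_rel e) p q](connect_rev (flip_rel e) q p).
move=> /(connect_homo (R' := [rel x y | flip_rel e y x]) (f := @swap _)).
rewrite !swapK; apply=> x y /flip_relP[tx ty [h hxy]].
apply/connect1/flip_relP; split; rewrite -?(is_top_rev e) ?swapK //.
by exists h; apply: (proj1 (flip_at_rev _ _ _ _)); rewrite !swapK.
Qed.
End TopOrderDual.

(** * If top(G) is a lattice then intervals of maximal orthogonal pairs overlap *)

(** For a cover this is the existence of a label; every interval contains a
cover, so the condition for all intervals is the same. *)
Definition overlapping (V : finType) (e : rel V) : Prop :=
  forall x y : mop e, (x < y)%O -> exists2 g, g \in mopM x & g \in mopJ y.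

Lemma lattice_bottom (T : finType) (le : rel T) (x0 : T) :
  is_lattice le -> exists b, forall y, le b y.
Proof.
case=> refl _ trans _ glb.
suff [b hb] : exists b, all (le b) (enum T).
  by exists b => y; apply: (allP hb); rewrite mem_enum.
elim: (enum T) => [|x s [b hb]]; first by exists x0.
have [c hc] := glb x b; have := hc c; rewrite refl => /esym/andP[cx cb].
exists c; rewrite /= cx; apply/allP => y /(allP hb); exact: trans.
Qed.

Lemma lattice_lub (T : finType) (le : rel T) (x0 : T) (I : finType)
    (A : {set I}) (f : I -> T) :
  is_lattice le -> exists z, forall w, le z w = [forall a in A, le (f a) w].
Proof.
move=> lat; have [b hb] := lattice_bottom x0 lat.
suff [z hz] : exists z, forall w, le z w = all (fun a => le (f a) w) (enum A).
  exists z => w; rewrite hz; apply/allP/forall_inP => h a; last first.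
    by rewrite mem_enum; apply: h.
  by move=> aA; apply: h; rewrite mem_enum.
elim: (enum A) => [|a s [z hz]]; first by exists b => w; rewrite hb.
case: lat => _ _ _ lub _; have [y hy] := lub (f a) z.
by exists y => w; rewrite hy hz.
Qed.

Section TopLattice.
Variables (V : finType) (e : rel V) (l l' : seq V).
Hypothesis lin_l : linear_extension e l.
Hypothesis revlin_l' : reverse_linear_extension e l'.
Hypothesis lat : is_lattice (@top_le V e l l').
Variables j m : V -> tops e.
Hypothesis jE : forall g, (val (j g)).1 = [set g].
Hypothesis mE : forall g, (val (m g)).2 = [set g].
Implicit Types (g h k : V) (t u w z : tops e).

Local Notation le := (@top_le V e l l').

Let rlin := rev_reverse_linear_extension revlin_l'.

Lemma top_leP t u : reflect (connect (flip_rel e) (val t) (val u)) (le t u).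
Proof. by rewrite (top_leE lin_l revlin_l'); apply: idP. Qed.

Lemma topP t : is_top e (val t).
Proof. by rewrite -(tightE lin_l) (valP t). Qed.

Lemma top_of p : is_top e p -> {t : tops e | val t = p}.
Proof. by rewrite -(tightE lin_l) => tp; exists (Top tp). Qed.

Lemma top_le_refl t : le t t. Proof. exact: connect0. Qed.
Lemma top_le_trans t u w : le t u -> le u w -> le t w.
Proof. exact: connect_trans. Qed.

Lemma j_le g t : g \in orthl e (val t).2 -> le (j g) t.
Proof.
by move=> gt; apply/top_leP/(join_gen_le lin_l revlin_l' _ _ (jE g) gt); apply: topP.
Qed.

Lemma le_m g t : g \in orthr e (val t).1 -> le t (m g).
Proof.
by move=> gt; apply/top_leP/(meet_gen_le lin_l revlin_l' _ _ (mE g) gt); apply: topP.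
Qed.

Lemma j_le_mem g t : g \in (val t).1 -> le (j g) t.
Proof. by case/and4P: (topP t) => _ _ /subsetP s _ /s; apply: j_le. Qed.

Lemma le_m_mem g t : g \in (val t).2 -> le t (m g).
Proof.
case/and4P: (topP t) => _ _; rewrite orth_galois => /subsetP s _ /s; exact: le_m.
Qed.

Lemma j_m_edge g k : ~~ hits e g k -> le (j g) (m k).
Proof. by move=> gk; apply: le_m; rewrite jE in_orthr1. Qed.

(** Let c be the top that separates the vertices below g, A0, from the others,
and let c' be its flip at g.  The join z of c and j g lies below c', so that D(z)
is contained in A = A0 with g added, but not in A0 because j g <= z; hence
g is in D(z).  If j g <= m g, then z <= m g, and in the same way U(z) avoids A0
but not A, so g is also in U(z). *)
Lemma j_nle_m g : ~~ le (j g) (m g).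
Proof.
apply/negP => jm; pose A0 := [set k | ggt e g k]; pose A := [set k | gge e g k].
have lA : lower e A by move=> x y xy; rewrite !inE => /gge_trans; apply.
have A0E : A0 = A :\ g by apply/setP => k; rewrite !inE /ggt eq_sym.
have lA0 : lower e A0.
  move=> x y xy; rewrite !inE => /andP[gx gx']; rewrite /ggt (gge_trans gx' xy) andbT.
  by apply: contraNneq gx => gy; apply/eqP/(gge_anti lin_l gx'); rewrite gy.
have [p [tp sD sU]] := lower_top lin_l revlin_l' lA0.
have gU : g \in p.2.
  rewrite (top_mem2 g tp); apply/andP; split.
    apply/orthrP => d /(subsetP sD); rewrite inE => /andP[gd gd'].
    by apply: contraNN gd => /hits_gge/(gge_anti lin_l gd')/eqP.
  apply/forall_inP => u /(subsetP sU); rewrite !inE negb_and negbK.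
  case/orP=> [/eqP <-|]; first by rewrite (edge_irr lin_l).
  by apply: contraNN => /connect1.
have [c cE] := top_of tp.
have [q tq fq] := flip_exists lin_l revlin_l' tp gU; have [c' c'E] := top_of tq.
have [_ _ _ lub _] := lat; have [z zE] := lub c (j g).
have [cz jz] : le c z /\ le (j g) z by apply/andP; rewrite -zE top_le_refl.
have zc' : le z c'.
  rewrite zE; apply/andP; split; last by apply: j_le_mem; rewrite c'E; case: fq.
  by apply/top_leP/connect1/flip_relP; rewrite cE c'E; split=> //; exists g.
have zm : le z (m g) by rewrite zE jm le_m_mem // cE.
have sDz : (val z).1 \subset A.
  move/top_leP: zc' => /(connect_lower1 lA); apply; rewrite c'E.
  apply/subsetP => k kq; rewrite inE; apply/negPn/negP => gk.
  case: fq => _ _ eD _; rewrite -eD // in kq.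
  by have := subsetP sD k kq; rewrite inE /ggt (negPf gk) andbF.
have gDz : g \in (val z).1.
  apply/negPn/negP => gz; have : (val z).1 \subset A0 by rewrite A0E subsetD1 sDz.
  move/top_leP: jz => /(connect_lower1 lA0) h /h; rewrite jE sub1set inE.
  by rewrite /ggt eqxx.
have sUz : (val z).2 \subset ~: A0.
  by move/top_leP: cz => /(connect_lower2 lA0); apply; rewrite cE.
have gUz : g \in (val z).2.
  apply/negPn/negP => gz; have : (val z).2 \subset ~: A.
    apply/subsetP => k kz; have := subsetP sUz k kz; rewrite A0E !inE negb_and negbK.
    by case/orP=> // /eqP kg; rewrite -kg kz in gz.
  move/top_leP: zm => /(connect_lower2 lA) h /h; rewrite mE sub1set !inE.
  by move/negP; apply; apply: connect0.
exact: top_disjoint (topP z) gDz gUz.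
Qed.

(** If the join z of the j d were smaller than t, it would lie below a flip of t
at some g in D(t), hence below m g, although j g <= z. *)
Lemma le_joins t w : (forall d, d \in (val t).1 -> le (j d) w) -> le t w.
Proof.
move=> tw; have [z zE] := lattice_lub t (val t).1 j lat.
have zt : le z t by rewrite zE; apply/forall_inP => d; apply: j_le_mem.
suff <- : z = t by rewrite zE; apply/forall_inP.
apply/eqP/negPn/negP => nzt; move: zt => /connect_last - /(_ nzt)[u zu].
rewrite (flip_upE lin_l revlin_l') => /flip_relP[_ _ [g [gu gt _ _]]].
have /negP[] := j_nle_m g; apply: top_le_trans (le_m_mem gu); apply: top_le_trans zu.
have := top_le_refl z; rewrite {1}zE => /forall_inP; exact.
Qed.

(** Suppose g -> k and j g <= m k, and let t be the join of j g and j k.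
Comparing t with the m h through [le_joins] shows that g and k both belong to
D(t), which is independent. *)
Lemma j_le_m g k : le (j g) (m k) = ~~ hits e g k.
Proof.
apply/idP/idP => [jm|]; last exact: j_m_edge.
apply/negP => /predU1P[gk|gk]; first by move: jm; rewrite gk (negPf (j_nle_m k)).
have [_ _ _ lub _] := lat; have [t tE] := lub (j g) (j k).
have hit a b : ~~ le (j a) (m b) -> hits e a b.
  by apply: contraNT; apply: j_m_edge.
have up h : h \in [set g; k] -> exists2 d, d \in (val t).1 & ~~ le (j d) (m h).
  move=> hgk; apply/exists_inP; rewrite -[[exists _ in _, _]]negbK negb_exists_in.
  apply/negP => /forall_inP th; have /negP := j_nle_m h; apply.
  have : le t (m h) by apply: le_joins => d dt; apply: negbNE (th d dt).
  by rewrite tE => /andP[]; case/set2P: hgk => ->.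
have down d : d \in (val t).1 -> ~~ (le (j g) (m d) && le (j k) (m d)).
  move=> dt; rewrite -tE; apply/negP => td.
  by have /negP[] := j_nle_m d; apply: top_le_trans td; apply: j_le_mem.
have idx a b : hits e a b -> index b l <= index a l.
  by move/hits_gge/(gge_index lin_l).
have gt : g \in (val t).1.
  have [d dt /hit/predU1P[<- //|dg]] := up g (set21 g k).
  have := down d dt; rewrite negb_and => hd; have : index d l <= index g l.
    case/orP: hd => /hit/idx // /leq_trans; apply; exact/ltnW/(edge_index lin_l).
  by rewrite leqNgt (edge_index lin_l dg).
have kt : k \in (val t).1.
  have [d dt dmk] := up k (set22 g k).
  have dg : d != g by apply: contraNneq dmk => ->.
  case/hit/predU1P: dmk => [<- //|dk].
  have := down d dt; rewrite negb_and => /orP[]/hit.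
    by rewrite /hits eq_sym (negPf dg) (negPf (top_ind1 (topP t) gt dt)).
  by move/idx; rewrite leqNgt (edge_index lin_l dk).
by have := top_ind1 (topP t) gt kt; rewrite gk.
Qed.

(** The top f x is the join of the j g with g in x_J, so f x <= m h says that h
is in x_M; in particular f is strictly increasing. *)
Lemma lattice_overlapping : overlapping e.
Proof.
have joins (x : mop e) : exists t, forall w, le t w = [forall a in mopJ x, le (j a) w].
  have [g _|V0] := pickP (@predT V); first exact: (lattice_lub (j g)).
  (* Without vertices the only top is the one with D empty. *)
have [p tp _] : exists2 p, is_top e p & p.1 = set0.
    apply: (top_of_independent lin_l revlin_l'); apply/independentP => a b.
    by rewrite inE.
  by have [t _] := top_of tp; apply: (lattice_lub t).
have [f fE] := fin_all_exists joins.
have fM x h : le (f x) (m h) = (h \in mopM x).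
  rewrite fE mopME; apply/forall_inP/orthrP => hx g /hx; by rewrite j_le_m.
move=> x y xy; have fxy : le (f x) (f y).
  rewrite fE; apply/forall_inP => g gx.
  have := top_le_refl (f y); rewrite {1}fE => /forall_inP; apply.
  by move: (ltW xy); rewrite -[(_ <= _)%O]/(mop_le _ _) => /subsetP; apply.
have nxy : f x != f y.
  apply: contraTneq xy => exy; suff -> : x = y by rewrite ltxx.
  have eM : mopM x = mopM y by apply/setP => h; rewrite -!fM exy.
  apply: val_inj; rewrite [val x]surjective_pairing [val y]surjective_pairing.
  by congr (_, _) => //; rewrite -/(mopJ x) -/(mopJ y) !mopJE eM.
have [u] := connect_first fxy nxy.
rewrite (flip_upE lin_l revlin_l') => /flip_relP[_ _ [g [gx gu _ _]]] uy.
exists g; first by rewrite -fM le_m_mem.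
have jgy : le (j g) (f y) by apply: top_le_trans uy; apply: j_le_mem.
rewrite mopJE; apply/orthlP => h; rewrite -fM -j_le_m; exact: top_le_trans.
Qed.

End TopLattice.

Lemma top_lattice_overlapping (V : finType) (e : rel V) l l' :
  linear_extension e l -> reverse_linear_extension e l' ->
  is_lattice (@top_le V e l l') -> overlapping e.
Proof.
move=> lin_l revlin_l' lat.
have ind1 g : independent e [set g].
  by apply/independentP => x y /set1P-> /set1P->; rewrite (edge_irr lin_l).
have exj g : exists t : tops e, (val t).1 = [set g].
  have [p tp pE] := top_of_independent lin_l revlin_l' (ind1 g).
  by have [t tE] := top_of lin_l tp; exists t; rewrite tE.
have exm g : exists t : tops e, (val t).2 = [set g].
  have [|p tp pE] := top_of_independent (rev_reverse_linear_extension revlin_l')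
    (rev_linear_extension lin_l) (D := [set g]); first by rewrite (independent_rev e).
  have [|t tE] := top_of lin_l (p := swap p); last by exists t; rewrite tE.
  by rewrite -(is_top_rev e); case: p tp {pE}.
have [j jE] := fin_all_exists exj; have [m mE] := fin_all_exists exm.
exact: (lattice_overlapping lin_l revlin_l' lat jE mE).
Qed.

(** * Trim lattices of maximal orthogonal pairs overlap *)

Section MaxOrthogonal.
Variables (V : finType) (e : rel V).
Implicit Types (x y z : mop e) (X Y : {set V}) (g h k : V).

Lemma leEmop x y : (x <= y)%O = (mopJ x \subset mopJ y). Proof. by []. Qed.

Lemma leEmopM x y : (x <= y)%O = (mopM y \subset mopM x).
Proof. exact: mop_leM. Qed.

Lemma mopJ_inj : injective (@mopJ V e).
Proof. by move=> x y exy; apply: le_anti; rewrite !leEmop exy subxx. Qed.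

Lemma mopM_inj : injective (@mopM V e).
Proof. by move=> x y exy; apply: le_anti; rewrite !leEmopM exy subxx. Qed.

Lemma mopJ_meet x y : mopJ (x `&` y)%O = mopJ x :&: mopJ y.
Proof. by rewrite (mopJE x) (mopJE y) -orthlU. Qed.

Lemma mopM_join x y : mopM (x `|` y)%O = mopM x :&: mopM y.
Proof. by rewrite (mopME x) (mopME y) -orthrU. Qed.

Lemma mop_of_J_le X x : (mop_of_J e X <= x)%O = (X \subset mopJ x).
Proof. by rewrite leEmopM mopJE orth_galois. Qed.

Lemma sub_mop_of_J X : X \subset mopJ (mop_of_J e X).
Proof. by rewrite -mop_of_J_le. Qed.

Lemma mop_disjoint x k : k \in mopJ x -> k \in mopM x -> False.
Proof. by rewrite mopJE => /orthlP h /h; rewrite hitsxx. Qed.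

Lemma mop_lower A : lower e A ->
  (mopJ (mop_of_J e A) = A) /\ (mopM (mop_of_J e A) = ~: A).
Proof.
move=> lA; have eA : orthr e A = ~: A.
  apply/setP => k; rewrite in_setC; apply/orthrP/idP => [h|kA x xA].
    by apply/negP => /h; rewrite hitsxx.
  by apply: contra kA => /hits_gge/lA; apply.
split=> //; rewrite mopJE /mopM /= eA; apply/setP => k.
apply/orthlP/idP => [h|kA x].
  by apply/negPn/negP => kA; have := h k; rewrite inE hitsxx => /(_ kA).
by rewrite inE; apply: contra => /hits_gge/lA; apply.
Qed.

End MaxOrthogonal.

Lemma lower_cover (d : Order.disp_t) (L : finTBLatticeType d) (x y : L) :
  (x < y)%O -> exists2 z, (x <= z)%O & covered z y.
Proof.
move=> xy; pose P z := (x <= z < y)%O.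
have Px : P x by rewrite /P lexx.
case: (arg_maxnP (fun z : L => #|[set w | w <= z]%O|) Px) => z /andP[xz zy] zmax.
exists z => //; rewrite /covered zy; apply/forallP => w; apply/negP => /andP[zw wy].
have := zmax w; rewrite /P wy (le_trans xz (ltW zw)) => /(_ isT).
rewrite /geq /= leqNgt => /negP[]; apply: proper_card; apply/properP; split.
  by apply/subsetP => u; rewrite !inE => /le_trans; apply; apply: ltW.
by exists w; rewrite !inE ?lexx // (lt_geF zw).
Qed.

Lemma connect_covered (d : Order.disp_t) (L : finTBLatticeType d) (x y : L) :
  (x <= y)%O -> connect (fun u v : L => covered u v) x y.
Proof.
have [n] := ubnP #|[set w : L | w < y]%O|; elim: n y => // n IHn y yn.
rewrite le_eqVlt => /predU1P[->|xy]; first exact: connect0.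
have [z xz zy] := lower_cover xy.
apply: connect_trans (connect1 zy); apply: IHn => //.
case/andP: zy => zy _; rewrite -ltnS; apply: leq_trans yn.
rewrite ltnS; apply: proper_card; apply/properP; split.
  by apply/subsetP => u; rewrite !inE => /lt_trans; apply.
by exists z; rewrite !inE ?ltxx.
Qed.

Section LeftModular.
Variables (V : finType) (e : rel V) (l : seq V).
Hypothesis lin_l : linear_extension e l.
Implicit Types (x y z m : mop e) (X Y : {set V}) (g h k : V).

Definition segment n := [set k | index k l < n].

Lemma segment_lower n : lower e (segment n).
Proof. by move=> x y /(gge_index lin_l) yx; rewrite !inE; apply: leq_ltn_trans. Qed.

(** Apply the modular law to the cover between the initial segments ending just
before and just after g. *)
Lemma left_modular_complement m : left_modular m -> mopJ m :|: mopM m = setT.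
Proof.
move=> lm; apply/setP => g; rewrite in_setT in_setU; apply/orP.
have [gJ|gJ] := boolP (g \in mopJ m); [by left | right].
pose c := mop_of_J e (segment (index g l)).
pose c' := mop_of_J e (segment (index g l).+1).
have [cJ cM] := mop_lower (segment_lower (n := index g l)).
have [c'J _] := mop_lower (segment_lower (n := (index g l).+1)).
have cc' : (c <= c')%O.
  by rewrite leEmop cJ c'J; apply/subsetP => k; rewrite !inE => /ltnW.
have mc : (m `&` c' <= c)%O.
  rewrite leEmop mopJ_meet cJ c'J; apply/subsetP => k; rewrite !inE ltnS.
  case/andP=> km; rewrite leq_eqVlt => /orP[/eqP/(index_ext_inj lin_l) kg|//].
  by rewrite -kg km in gJ.
have := lm; move/forallP/(_ c)/forallP/(_ c')/implyP/(_ cc')/eqP.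
rewrite (join_l mc) => cmc.
have : g \notin mopJ ((c `|` m) `&` c')%O by rewrite cmc cJ inE ltnn.
have gS : g \in segment (index g l).+1 by rewrite inE.
rewrite mopJ_meet in_setI c'J gS andbT mopJE => /orthlPn[h].
rewrite mopM_join cM in_setI in_setC inE -leqNgt => /andP[gh hm].
case/predU1P=> [-> //|/(edge_index lin_l)].
by rewrite ltnNge gh.
Qed.

(** In a maximal chain of left modular elements let m be the last element with
m /\ y <= x, and m' the next one.  As m_J and m'_J are down-closed, adding to
m_J the first vertex s of m'_J outside it yields an element comparable to the
whole chain, so m'_J = m_J + s.  Then s is in y_J but not in x_J, and the
modular law (x \/ m) /\ y = x forces s into x_M. *)
Lemma left_modular_overlapping : left_modular_lattice (mop e) -> overlapping e.
Proof.
case/existsP=> C /andP[/maxsetP[chC maxC] /forall_inP lmC] x y xy.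
have cmp m m' : m \in C -> m' \in C -> (m <= m')%O || (m' <= m)%O.
  by move=> mC m'C; move/'forall_in_forall_inP: chC; apply.
have inC m : (forall c, c \in C -> (m <= c)%O || (c <= m)%O) -> m \in C.
  move=> hm; rewrite -(maxC (m |: C)) ?setU11 ?subsetUr //.
  apply/'forall_in_forall_inP => a /setU1P[->|aC] b /setU1P[->|bC].
  - by rewrite comparablexx.
  - exact: hm.
  - by rewrite comparable_sym; apply: hm.
  - exact: cmp.
have PB : (\bot%O : mop e) \in [pred m in C | (m `&` y <= x)%O].
  by rewrite inE meet0x le0x andbT inC // => c _; rewrite le0x.
have PT : (\top%O : mop e) \in [pred m in C | ~~ (m `&` y <= x)%O].
  by rewrite inE meet1x (lt_geF xy) andbT inC // => c _; rewrite lex1 orbT.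
case: (arg_maxnP (fun m : mop e => #|mopJ m|) PB) => m /andP[mC mx] mmax.
case: (arg_minnP (fun m : mop e => #|mopJ m|) PT) => m' /andP[m'C m'x] m'min.
have low_m c : c \in C -> (c `&` y <= x)%O -> (c <= m)%O.
  move=> cC cx; have /orP[//|mc] := cmp c m cC mC.
  suff -> : m = c by [].
  by apply/mopJ_inj/eqP; rewrite eqEcard -leEmop mc; apply: mmax; rewrite /= cC.
have up_m c : c \in C -> ~~ (c `&` y <= x)%O -> (m' <= c)%O.
  move=> cC cx; have /orP[//|mc] := cmp m' c m'C cC.
  suff -> : c = m' by [].
  by apply/mopJ_inj/eqP; rewrite eqEcard -leEmop mc; apply: m'min; rewrite /= cC.
have mm' : (m <= m')%O.
  have /orP[//|h] := cmp m m' mC m'C; case/negP: m'x.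
  exact: le_trans (leI2 h (lexx y)) mx.
have compl c k : c \in C -> (k \in mopM c) = (k \notin mopJ c).
  move=> /lmC/left_modular_complement/setP/(_ k); rewrite in_setT in_setU.
  by case: (boolP (k \in mopJ c)) => [kJ _|//]; apply/negP => /(mop_disjoint kJ).
have lowC c : c \in C -> lower e (mopJ c).
  move=> cC a b /connectP[s sP ->] {b}; elim: s a sP => //= b s IHs a.
  case/andP=> ab /IHs {}IHs aJ; apply: IHs; rewrite -[_ \in _]negbK -compl //.
  by rewrite mopME; apply/orthrPn; exists a; rewrite // /hits ab orbT.
have [s /andP[sm' sm] smin] : exists2 s, (s \in mopJ m') && (s \notin mopJ m) &
    forall k, k \in mopJ m' -> k \notin mopJ m -> index s l <= index k l.
  have /subsetPn[s0 s0m' s0m] : ~~ (mopJ m' \subset mopJ m).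
    apply/negP => h; case/negP: m'x.
    exact: le_trans (leI2 (h : (m' <= m)%O) (lexx y)) mx.
  have P0 : s0 \in [pred k | (k \in mopJ m') && (k \notin mopJ m)].
    by rewrite inE s0m'.
  case: (arg_minnP (fun k => index k l) P0) => s sP smin; exists s => // k km' km.
  by apply: smin; rewrite /= km'.
have lows : lower e (s |: mopJ m).
  move=> a b ab /setU1P[as_|am]; last by apply/setU1P; right; apply: lowC ab am.
  rewrite as_ in ab; rewrite in_setU1; apply/orP.
  have [bm|bm] := boolP (b \in mopJ m); [by right | left].
  apply/eqP/(index_ext_inj lin_l)/eqP; rewrite eqn_leq (gge_index lin_l ab).
  by rewrite smin // (lowC _ m'C s).
have [zJ _] := mop_lower lows; set z := mop_of_J e _ in zJ.
have zm' : (z <= m')%O by rewrite leEmop zJ subUset sub1set sm' -leEmop.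
have m'z : (m' <= z)%O.
  have zC : z \in C.
    apply: inC => c cC; have [cx|cx] := boolP (c `&` y <= x)%O.
      apply/orP; right; apply: le_trans (low_m c cC cx) _.
      by rewrite leEmop zJ subsetUr.
    by apply/orP; left; apply: le_trans zm' (up_m c cC cx).
  have [zx|] := boolP (z `&` y <= x)%O; last exact: up_m.
  by have := low_m z zC zx; rewrite leEmop zJ subUset sub1set (negPf sm).
have m'E : mopJ m' = s |: mopJ m.
  by rewrite -zJ; congr mopJ; apply: le_anti; rewrite m'z.
have [sy sx] : s \in mopJ y /\ s \notin mopJ x.
  move: m'x; rewrite leEmop mopJ_meet m'E => /subsetPn[k].
  case/setIP=> /setU1P[->|km] ky kx //; case/negP: kx.
  by move: mx; rewrite leEmop mopJ_meet => /subsetP; apply; rewrite inE km.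
exists s => //; have := lmC m mC; move/forallP/(_ x)/forallP/(_ y).
move/implyP/(_ (ltW xy))/eqP; rewrite (join_l mx) => xmy.
have : s \notin mopJ ((x `|` m) `&` y)%O by rewrite xmy.
rewrite mopJ_meet in_setI sy andbT mopJE => /orthlPn[h].
rewrite mopM_join in_setI (compl m h mC) => /andP[hx hm] /hits_gge/lows.
by rewrite setU11 in_setU1 (negPf hm) orbF => /(_ isT)/eqP <-.
Qed.

End LeftModular.

(** * Edge reversal of maximal orthogonal pairs *)

Fact rev_mop_subproof (V : finType) (e : rel V) (x : mop e) :
  max_orthogonal (rev_edge e) (mopM x, mopJ x).
Proof.
by rewrite max_orthogonalE /= (orthl_rev e) (orthr_rev e) -mopME -mopJE !eqxx.
Qed.

Definition rev_mop (V : finType) (e : rel V) (x : mop e) : mop (rev_edge e) :=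
  Mop (rev_mop_subproof x).

Section Reversal.
Variables (V : finType) (e : rel V).
Implicit Types (x y z : mop e).

Lemma rev_mop_inj : injective (@rev_mop V e).
Proof. by move=> x y /(congr1 (@mopM V _))/mopJ_inj. Qed.

Lemma rev_mop_surj (x : mop (rev_edge e)) : exists y : mop e, x = rev_mop y.
Proof. by exists (rev_mop x); apply: mopJ_inj. Qed.

Lemma le_rev_mop x y : (rev_mop y <= rev_mop x)%O = (x <= y)%O.
Proof. by rewrite [RHS]leEmopM. Qed.

Lemma lt_rev_mop x y : (rev_mop y < rev_mop x)%O = (x < y)%O.
Proof. by rewrite !lt_neqAle le_rev_mop (inj_eq rev_mop_inj) eq_sym. Qed.

Lemma covered_rev_mop x y : covered (rev_mop y) (rev_mop x) = covered x y.
Proof.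
rewrite /covered lt_rev_mop; congr (_ && _); apply/forallP/forallP => h z.
  by rewrite -!lt_rev_mop andbC.
by have [z' ->] := rev_mop_surj z; rewrite !lt_rev_mop andbC.
Qed.

Lemma overlapping_rev : overlapping e -> overlapping (rev_edge e).
Proof.
move=> ov x y; have [x' ->] := rev_mop_surj x; have [y' ->] := rev_mop_surj y.
by rewrite lt_rev_mop => /ov[g gM gJ]; exists g.
Qed.

Lemma rev_mop_meet x y : rev_mop (x `&` y)%O = (rev_mop x `|` rev_mop y)%O.
Proof. by apply: mopM_inj; rewrite mopM_join /= -mopJ_meet. Qed.

Lemma join_irreducible_rev x :
  join_irreducible (rev_mop x) = meet_irreducible x.
Proof.
rewrite /join_irreducible /meet_irreducible.
have -> : (\bot : mop (rev_edge e))%O = rev_mop (\top : mop e)%O.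
  apply/eqP; rewrite eq_le le0x /=; have [b ->] := rev_mop_surj (\bot)%O.
  by rewrite le_rev_mop lex1.
rewrite (inj_eq rev_mop_inj); congr (_ && _).
apply/'forall_'forall_implyP/'forall_'forall_implyP => h y z.
  by have := h (rev_mop y) (rev_mop z); rewrite -rev_mop_meet !(inj_eq rev_mop_inj).
have [y' ->] := rev_mop_surj y; have [z' ->] := rev_mop_surj z.
by rewrite -rev_mop_meet !(inj_eq rev_mop_inj); apply: h.
Qed.

End Reversal.

(** * Overlapping lattices of maximal orthogonal pairs are trim *)

Section Extremal.
Variables (V : finType) (e : rel V) (l : seq V).
Hypothesis lin_l : linear_extension e l.
Implicit Types (x y z m w : mop e) (A X Y : {set V}) (g h k : V).

Lemma join_irreducible_gen g : join_irreducible (mop_of_J e [set g]).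
Proof.
set x := mop_of_J e _; have gx : g \in mopJ x by rewrite -sub1set sub_mop_of_J.
have gnM : g \notin mopM x by apply/negP => /(mop_disjoint gx).
have below w : (w <= x)%O -> g \notin mopM w -> x = w.
  move=> wx; rewrite mopME => /orthrPn[h hw hg]; apply/eqP.
  rewrite eq_le wx andbT mop_of_J_le sub1set.
  case/predU1P: (hg) => [<- //|ehg]; have hx : h \in mopJ x by apply: (subsetP wx).
  case: (mop_disjoint hx); rewrite in_orthr1; apply/negP => /predU1P[gh|].
    by rewrite gh (edge_irr lin_l) in ehg.
  by move=> egh; case: (edge_asym lin_l egh ehg).
rewrite /join_irreducible; apply/andP; split.
  by apply: contraNneq gnM => ->; apply/orthrP => a; rewrite inE.
apply/forallP => y; apply/forallP => z; apply/implyP => /eqP xyz.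
move: (gnM); rewrite xyz mopM_join in_setI negb_and -xyz.
have yx : (y <= x)%O by rewrite xyz leUl.
have zx : (z <= x)%O by rewrite xyz leUr.
by case/orP=> [/(below _ yx) xy|/(below _ zx) xz]; apply/orP; [left|right]; apply/eqP.
Qed.

(** Write x as a join of generators over a set A of least cardinality; then A
cannot be split. *)
Lemma join_irreducible_inv x :
  join_irreducible x -> exists g, x = mop_of_J e [set g].
Proof.
case/andP=> x0 /forallP irr.
have P0 : mopJ x \in [pred A | mop_of_J e A == x].
  by rewrite inE; apply/eqP/mopM_inj; rewrite [RHS]mopME.
case: (arg_minnP (fun A : {set V} => #|A|) P0) => A /eqP Ax Amin.
have [A0|[g gA]] := set_0Vmem A; first by rewrite -Ax A0 eqxx in x0.
have xE : x = (mop_of_J e [set g] `|` mop_of_J e (A :\ g))%O.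
  by apply: mopM_inj; rewrite mopM_join -orthrU setD1K // -Ax.
have := irr (mop_of_J e [set g]); move/forallP/(_ (mop_of_J e (A :\ g))).
rewrite -xE eqxx => /orP[/eqP xg|/eqP xA]; first by exists g.
have := Amin (A :\ g); rewrite /= -xA eqxx => /(_ isT).
by rewrite /geq /= (cardsD1 g A) gA ltnn.
Qed.

Lemma card_join_irreducible : #|[set x : mop e | join_irreducible x]| = #|V|.
Proof.
have -> : [set x : mop e | join_irreducible x] =
    [set mop_of_J e [set g] | g in [set: V]].
  apply/setP => x; rewrite inE; apply/idP/imsetP => [/join_irreducible_inv[g ->]|].
    by exists g; rewrite ?inE.
  by case=> g _ ->; apply: join_irreducible_gen.
rewrite card_in_imset ?cardsT // => g h _ _ /(congr1 (@mopM V e)) egh.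
apply: set1_inj; apply: (orthr_inj lin_l) egh; apply/independentP => a b;
  by move=> /set1P-> /set1P->; rewrite (edge_irr lin_l).
Qed.

Lemma size_ext : size l = #|V|.
Proof. by rewrite (perm_size (proj1 lin_l)) cardE. Qed.

Lemma card_segment n : n <= #|V| -> #|segment l n| = n.
Proof.
move=> nV; have ul : uniq l by rewrite (perm_uniq (proj1 lin_l)) enum_uniq.
have -> : #|segment l n| = #|take n l|.
  apply: eq_card => k; rewrite inE in_take //.
  by rewrite (perm_mem (proj1 lin_l)) mem_enum.
by rewrite (card_uniqP (take_uniq n ul)) size_takel ?size_ext.
Qed.

Definition segments : {set mop e} :=
  [set mop_of_J e (segment l (i : 'I_#|V|.+1)) | i in [set: 'I_#|V|.+1]].

Lemma segments_chain : chain segments.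
Proof.
apply/'forall_in_forall_inP => _ /imsetP[i _ ->] _ /imsetP[j _ ->].
have leS a b : a <= b -> (mop_of_J e (segment l a) <= mop_of_J e (segment l b))%O.
  move=> ab; have [aJ _] := mop_lower (segment_lower lin_l (n := a)).
  have [bJ _] := mop_lower (segment_lower lin_l (n := b)).
  rewrite leEmop aJ bJ; apply/subsetP => k; rewrite !inE => /leq_trans; exact.
rewrite /Order.comparable; case/orP: (leq_total i j) => /leS ->; by rewrite ?orbT.
Qed.

Lemma chain_card (C : {set mop e}) : chain C ->
  {in C &, injective (fun x => #|mopJ x|)}.
Proof.
move=> chC x y xC yC exy; apply: mopJ_inj; apply/eqP.
move/'forall_in_forall_inP: chC => /(_ x xC y yC); rewrite /Order.comparable !leEmop.
case/orP => sxy; first by rewrite eqEcard sxy exy leqnn.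
by rewrite eq_sym eqEcard sxy exy leqnn.
Qed.

Lemma mop_length : lattice_length (mop e) = #|V|.
Proof.
apply/eqP; rewrite eqn_leq; apply/andP; split.
  apply/bigmax_leqP => C chC; rewrite -subn1 leq_subLR add1n.
  rewrite -[X in _ <= X]card_ord.
  apply: (@leq_card_in _ _ (fun x : mop e => inord #|mopJ x| : 'I_#|V|.+1)).
  move=> x y xC yC /(congr1 val)/=; rewrite !inordK ?ltnS ?max_card // => exy.
  exact: chain_card chC _ _ xC yC exy.
apply: leq_trans (leq_bigmax_cond _ segments_chain).
rewrite card_imset ?cardsT ?card_ord // => i j /(congr1 (@mopJ V e)).
rewrite !(proj1 (mop_lower (segment_lower lin_l (n := _)))).
move/(congr1 (fun A : {set V} => #|A|)); rewrite !card_segment ?leq_ord //.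
exact: val_inj.
Qed.

Lemma segments_maxset : maxset (@chain _ (mop e)) segments.
Proof.
apply/maxsetP; split=> [|D chD sD]; first exact: segments_chain.
apply/eqP; rewrite eqEsubset sD andbT; apply/subsetP => x xD.
have iV : #|mopJ x| < #|V|.+1 by rewrite ltnS max_card.
have zS : mop_of_J e (segment l (Ordinal iV)) \in segments by apply: imset_f.
rewrite (_ : x = mop_of_J e (segment l (Ordinal iV))) //.
apply: (chain_card chD xD (subsetP sD _ zS)).
by rewrite (proj1 (mop_lower (segment_lower lin_l (n := _)))) card_segment.
Qed.

(** Otherwise some g lies in the M-part of the smaller and in the J-part of the
larger side.  If g is in A, it is in z_J, hence in (c /\ z)_J; if not, it is in
c_M and in y_M, hence in (y \/ c)_M.  Either way g would be in both parts of
one pair. *)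
Lemma overlapping_left_modular A : lower e A -> overlapping e ->
  left_modular (mop_of_J e A).
Proof.
move=> lA ov; have [cJ cM] := mop_lower lA; set c := mop_of_J e A in cJ cM *.
apply/forallP => y; apply/forallP => z; apply/implyP => yz.
have ab : (y `|` (c `&` z) <= (y `|` c) `&` z)%O.
  by rewrite lexI !leUx yz leUl leIr andbT (le_trans (leIl _ _) (leUr _ _)).
rewrite eq_sym; apply: contraTT isT => nab.
have [|g] := ov (y `|` (c `&` z))%O ((y `|` c) `&` z)%O.
  by rewrite lt_neqAle nab.
rewrite mopM_join mopJ_meet !in_setI => /andP[gy gcz] /andP[gyc gz].
have [gA|gA] := boolP (g \in A).
  by case: (@mop_disjoint V e (c `&` z)%O g) => //; rewrite mopJ_meet in_setI cJ gA.
case: (mop_disjoint gyc); by rewrite mopM_join in_setI gy cM in_setC.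
Qed.

End Extremal.

Lemma mop_extremal (V : finType) (e : rel V) l l' :
  linear_extension e l -> reverse_linear_extension e l' -> extremal (mop e).
Proof.
move=> lin_l revlin_l'; rewrite /extremal (mop_length lin_l); apply/andP; split.
  by apply/eqP/esym; apply: (card_join_irreducible lin_l).
apply/eqP; apply: (etrans _ (card_imset _ (@rev_mop_inj V e))).
apply: (etrans (esym (card_join_irreducible (rev_reverse_linear_extension revlin_l')))).
congr #|pred_of_set _|.
apply/setP => x; have [y ->] := rev_mop_surj x.
by rewrite (mem_imset _ _ (@rev_mop_inj V e)) !inE join_irreducible_rev.
Qed.

Lemma overlapping_trim (V : finType) (e : rel V) l l' :
  linear_extension e l -> reverse_linear_extension e l' ->
  overlapping e -> trim (mop e).
Proof.
move=> lin_l revlin_l' ov; rewrite /trim (mop_extremal lin_l revlin_l') /=.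
apply/existsP; exists (segments e l); rewrite segments_maxset //.
apply/forall_inP => _ /imsetP[i _ ->]; apply: overlapping_left_modular ov.
exact: segment_lower.
Qed.

(** * The labels of covers in an overlapping lattice *)

(** The join z of a with the vertices of a_M that lie in b_J is b itself, since
nothing is left in the overlap of z < b. *)
Lemma overlapping_M (V : finType) (e : rel V) (a b : mop e) : overlapping e ->
  (a <= b)%O -> mopM b = mopM a :&: orthr e (mopM a :&: mopJ b).
Proof.
move=> ov ab; set X := mopM a :&: mopJ b; pose z := (a `|` mop_of_J e X)%O.
have zb : (z <= b)%O by rewrite leUx ab mop_of_J_le subsetIr.
have zM : mopM z = mopM a :&: orthr e X by rewrite mopM_join.
rewrite -zM; congr mopM; apply/esym/eqP/negPn/negP => nzb.
have [|g] := ov z b; first by rewrite lt_neqAle nzb.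
rewrite zM in_setI => /andP[ga /orthrP gX] gb.
by have := gX g; rewrite in_setI ga gb hitsxx => /(_ isT).
Qed.

Lemma overlapping_J (V : finType) (e : rel V) (a b : mop e) : overlapping e ->
  (a <= b)%O -> mopJ a = mopJ b :&: orthl e (mopM a :&: mopJ b).
Proof.
move=> ov ab; have := @overlapping_M _ _ (rev_mop b) (rev_mop a) (overlapping_rev ov).
by rewrite le_rev_mop (orthr_rev e) [X in orthl e X]setIC => /(_ ab).
Qed.

Lemma Dlabels_rev (V : finType) (e : rel V) (x : mop e) :
  Dlabels (rev_mop x) = Ulabels x.
Proof.
apply/setP => g; rewrite !inE; apply/existsP/existsP => -[z].
  have [z' ->] := rev_mop_surj z; rewrite covered_rev_mop setIC => h.
  by exists z'.
by move=> h; exists (rev_mop z); rewrite covered_rev_mop setIC.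
Qed.

Section Labels.
Variables (V : finType) (e : rel V) (l : seq V).
Hypothesis lin_l : linear_extension e l.
Hypothesis ov : overlapping e.
Implicit Types (x y z w : mop e) (g h k : V).

(** If a and b are both in the overlap of the cover, then y is the join of x and
a, and b, which leaves x_M, must be hit by a; by symmetry two distinct labels
would form a directed cycle. *)
Lemma cover_label x y : covered x y -> exists g, mopM x :&: mopJ y = [set g].
Proof.
case/andP=> xy /forallP no; have key a b : a \in mopM x :&: mopJ y ->
    b \in mopM x :&: mopJ y -> hits e a b.
  move=> /setIP[ax ay] /setIP[bx by_]; pose z := (x `|` mop_of_J e [set a])%O.
  have zy : (z <= y)%O by rewrite leUx (ltW xy) mop_of_J_le sub1set.
  have xz : (x < z)%O.
    rewrite lt_neqAle leUl andbT; apply/eqP => exz; apply: (mop_disjoint _ ax).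
    by rewrite exz (subsetP (leUr _ x : mop_le _ z)) // -sub1set sub_mop_of_J.
  have ezy : z = y.
    by apply/eqP; have := no z; rewrite xz lt_neqAle zy andbT negbK.
  rewrite -[hits _ _ _]negbK; apply/negP => ab; apply: (mop_disjoint by_).
  by rewrite -ezy mopM_join in_setI bx in_orthr1.
have [g gx gy] := ov xy; have gxy : g \in mopM x :&: mopJ y by rewrite in_setI gx.
exists g; apply/setP => h; rewrite in_set1; apply/idP/eqP => [hxy|-> //].
case/predU1P: (key g h gxy hxy) => [//|gh].
by case/predU1P: (key h g hxy gxy) => [//|hg]; case: (edge_asym lin_l gh hg).
Qed.

(** Put w = x1 /\ x2.  A vertex k of w_M that is in y_J but not in x2_J leaves
x2_M unless k = g2, so [overlapping_M] for w <= x2 yields some h -> k in w_M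
and x2_J; the same holds with x1 and x2 exchanged.  No element of w_M is in
both x1_J and x2_J, so the step can be repeated from h.  When g1 -> g2 it
applies to g1 and then to all vertices reached, which come after g1 in the
linear extension and thus differ from g1 and g2: an infinite ascent. *)
Lemma lower_cover_edge_free x1 x2 y g1 g2 : (x1 < y)%O -> (x2 < y)%O ->
  mopM x1 :&: mopJ y = [set g1] -> mopM x2 :&: mopJ y = [set g2] -> ~~ e g1 g2.
Proof.
move=> x1y x2y l1 l2; apply/negP => g12; pose w := (x1 `&` x2)%O.
pose T := mopM w :&: (mopJ x1 :|: mopJ x2).
have step x k g : (w <= x)%O -> mopM x :&: mopJ y = [set g] ->
    mopJ x \subset mopJ x1 :|: mopJ x2 ->
    k \in mopM w -> k \in mopJ y -> k != g -> k \notin mopJ x ->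
    exists2 h, h \in T & e h k.
  move=> wx lx sx kw ky kg kx.
  have kxM : k \notin mopM x.
    by apply: contraNN kg => kM; rewrite -in_set1 -lx in_setI kM.
  move: kxM; rewrite (overlapping_M ov wx) in_setI kw /= => /orthrPn[h /setIP[hw hx]].
  case/predU1P=> [hk|hk]; first by rewrite -hk hx in kx.
  by exists h => //; rewrite in_setI hw (subsetP sx).
have sub x : x \in [:: x1; x2] -> mopJ x \subset mopJ y.
  by rewrite !inE => /orP[] /eqP ->; [apply: (ltW x1y) | apply: (ltW x2y)].
have notboth k : k \in mopM w -> k \in mopJ x1 -> k \in mopJ x2 -> False.
  by move=> kw k1 k2; apply: (mop_disjoint _ kw); rewrite mopJ_meet in_setI k1.
have up k : k \in T -> k != g1 -> k != g2 -> exists2 h, h \in T & e h k.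
  case/setIP=> kw /setUP[k1|k2] kg1 kg2.
    apply: (step x2 k g2); rewrite ?leIl ?leIr ?subsetUr //.
      by rewrite (subsetP (sub x1 _)) ?inE ?eqxx.
    by apply/negP; apply: notboth.
  apply: (step x1 k g1); rewrite ?leIl ?leIr ?subsetUl //.
    by rewrite (subsetP (sub x2 _)) ?inE ?eqxx ?orbT.
  by apply/negP => k1; apply: notboth k2.
have [g1x g1y] : g1 \in mopM x1 /\ g1 \in mopJ y.
  by apply/andP; rewrite -in_setI l1 set11.
have g1w : g1 \in mopM w.
  by apply: (subsetP (_ : mopM x1 \subset mopM w)) g1x; rewrite -leEmopM leIl.
have noT k : k \in T -> index g1 l < index k l -> False.
  elim/(source_ind lin_l): k => k IH kT g1k.
  have [||h hT hk] := up k kT.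
  - by apply: contraTneq g1k => ->; rewrite ltnn.
  - apply: contraTneq g1k => ->; rewrite -leqNgt; exact/ltnW/(edge_index lin_l).
  by apply: (IH h hk hT); apply: ltn_trans g1k (edge_index lin_l hk).
have [||h hT hg] := step x2 g1 g2 (leIr _ _) l2 (subsetUr _ _) g1w g1y.
- by apply: contraTneq g12 => ->; rewrite (edge_irr lin_l).
- rewrite (overlapping_J ov (ltW x2y)) l2 in_setI g1y /= in_orthl1 negbK.
  by rewrite /hits g12 orbT.
exact: noT h hT (edge_index lin_l hg).
Qed.

Lemma DlabelsP y g : reflect
  (exists x, [/\ covered x y, (x < y)%O & mopM x :&: mopJ y = [set g]])
  (g \in Dlabels y).
Proof.
rewrite inE; apply: (iffP existsP) => [[x /andP[cxy /eqP lx]]|[x [cxy _ lx]]].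
  by exists x; split=> //; case/andP: cxy.
by exists x; rewrite cxy lx /=.
Qed.

Lemma Dlabels_independent y : independent e (Dlabels y).
Proof.
apply/independentP => g1 g2 /DlabelsP[x1 [_ x1y l1]] /DlabelsP[x2 [_ x2y l2]].
exact: lower_cover_edge_free x1y x2y l1 l2.
Qed.

(** If the join of D(y) were smaller than y, it would lie below some x covered by
y, whose label is in D(y) but not in x_J. *)
Lemma mop_of_J_Dlabels y : mop_of_J e (Dlabels y) = y.
Proof.
have sDy : Dlabels y \subset mopJ y.
  apply/subsetP => g /DlabelsP[x [_ _ lx]].
  by have := set11 g; rewrite -lx => /setIP[].
apply/eqP/negPn/negP => ny; have : (mop_of_J e (Dlabels y) < y)%O.
  by rewrite lt_neqAle ny mop_of_J_le.
case/lower_cover=> x; rewrite mop_of_J_le => /subsetP sD cxy.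
have [g lx] := cover_label cxy; have := set11 g; rewrite -lx => /setIP[gx _].
apply: mop_disjoint gx; apply: sD; apply/DlabelsP; exists x; split=> //.
by case/andP: cxy.
Qed.

Lemma mopM_Dlabels y : mopM y = orthr e (Dlabels y).
Proof. by rewrite -[in LHS](mop_of_J_Dlabels y). Qed.

End Labels.

(** * The isomorphism *)

Section Isomorphism.
Variables (V : finType) (e : rel V) (l l' : seq V).
Hypothesis lin_l : linear_extension e l.
Hypothesis revlin_l' : reverse_linear_extension e l'.
Hypothesis ov : overlapping e.
Implicit Types (x y z w : mop e) (g h k : V).

Let rlin := rev_reverse_linear_extension revlin_l'.
Let rov := overlapping_rev ov.

Lemma Ulabels_independent y : independent e (Ulabels y).
Proof.
rewrite -Dlabels_rev -(independent_rev e); exact: (Dlabels_independent rlin rov).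
Qed.

Lemma mopJ_Ulabels y : mopJ y = orthl e (Ulabels y).
Proof.
by rewrite -Dlabels_rev -(orthr_rev e) -(mopM_Dlabels rlin rov).
Qed.

Lemma labels_top y : is_top e (Dlabels y, Ulabels y).
Proof.
apply/and4P; split=> /=.
- exact: (Dlabels_independent lin_l ov).
- exact: Ulabels_independent.
- by rewrite -mopJ_Ulabels -mop_of_J_le (mop_of_J_Dlabels lin_l ov).
rewrite -mopJ_Ulabels -(mopM_Dlabels lin_l ov) disjoint_subset.
by apply/subsetP => k kJ; apply/negP => /(mop_disjoint kJ).
Qed.

Lemma labels_tight y : tight e (Dlabels y, Ulabels y).
Proof. by rewrite (tightE lin_l) labels_top. Qed.

Definition labels y : tops e := Top (labels_tight y).

(** By [top_mem1] the part of D that is not below g is determined by the part of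
x_J not below g, and x_J differs from y_J only at g and at vertices k -> g;
such a k cannot be in D(y), as g is. *)
Lemma Dlabels_agree x y g k : covered x y -> mopM x :&: mopJ y = [set g] ->
  ~~ gge e g k -> (k \in Dlabels x) = (k \in Dlabels y).
Proof.
move=> cxy lx; have [xy _] := andP cxy.
have memD z h : (h \in Dlabels z) = (h \in mopJ z) && [forall d in Dlabels z, ~~ e d h].
  by rewrite (top_mem1 h (labels_top z)) /= -mopJ_Ulabels.
have gD : g \in Dlabels y by apply/DlabelsP; exists x.
elim/(source_ind lin_l): k => k IH gk.
have noD : [forall d in Dlabels x, ~~ e d k] = [forall d in Dlabels y, ~~ e d k].
  apply: eq_forallb => d; have [dk|_] := boolP (e d k); last by rewrite !implybT.
  rewrite (IH d dk) //; apply: contraNN gk => gd; exact: gge_trans gd (connect1 dk).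
have [kg|kg] := boolP (hits e k g).
  case/predU1P: kg => [kg|kg]; first by rewrite kg /gge connect0 in gk.
  apply/idP/idP => kD; last first.
    by have := top_ind1 (labels_top y) kD gD; rewrite kg.
  move: kD; rewrite !memD noD => /andP[kx ->].
  by rewrite (subsetP (ltW xy : mop_le x y)).
rewrite !memD noD (overlapping_J ov (ltW xy)) lx in_setI in_orthl1 kg andbT //.
Qed.

End Isomorphism.

Section IsomorphismEnd.
Variables (V : finType) (e : rel V) (l l' : seq V).
Hypothesis lin_l : linear_extension e l.
Hypothesis revlin_l' : reverse_linear_extension e l'.
Hypothesis ov : overlapping e.
Implicit Types (x y z w : mop e) (g h k : V).

Local Notation phi := (labels lin_l revlin_l' ov).

Lemma labels_flip x y g : covered x y -> mopM x :&: mopJ y = [set g] ->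
  flip_at e g (val (phi x)) (val (phi y)).
Proof.
move=> cxy lx; split=> /=.
- by rewrite inE; apply/existsP; exists y; rewrite cxy lx /=.
- by rewrite inE; apply/existsP; exists x; rewrite cxy lx /=.
- by move=> k; apply: (Dlabels_agree lin_l revlin_l' ov cxy lx).
move=> k kg; rewrite -!Dlabels_rev; apply/esym.
apply: (@Dlabels_agree _ _ l' l (rev_reverse_linear_extension revlin_l')
  (rev_linear_extension lin_l) (overlapping_rev ov) _ _ g).
- by rewrite covered_rev_mop.
- by rewrite setIC.
by rewrite gge_rev.
Qed.

Lemma labelsK : cancel phi (fun t : tops e => mop_of_J e (val t).1).
Proof. by move=> x; apply: (mop_of_J_Dlabels lin_l ov). Qed.

(** The inverse sends (D, U) to the join of D: both D and the labels of that join
have the same right orthogonal. *)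
Lemma labels_bij : bijective phi.
Proof.
exists (fun t : tops e => mop_of_J e (val t).1); first exact: labelsK.
move=> t; apply: val_inj; set y := mop_of_J e _.
have tt : is_top e (val t) by rewrite -(tightE lin_l) (valP t).
apply: (top_eq1 revlin_l' _ tt); first exact: (labels_top lin_l revlin_l' ov).
apply: (orthr_inj lin_l); first exact: (Dlabels_independent lin_l ov).
  by case/and4P: tt.
by rewrite -(mopM_Dlabels lin_l ov).
Qed.

Lemma labels_le x y : top_le l l' (phi x) (phi y) = (x <= y)%O.
Proof.
have cov_flip u v : covered u v -> flip_up l l' (phi u) (phi v).
  move=> cuv; have [g lg] := cover_label lin_l ov cuv.
  rewrite (flip_upE lin_l revlin_l'); apply/flip_relP; split.
  - exact: (labels_top lin_l revlin_l' ov).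
  - exact: (labels_top lin_l revlin_l' ov).
  by exists g; apply: labels_flip.
apply/idP/idP => [|/connect_covered]; last first.
  by apply: connect_homo => u v /cov_flip/connect1.
pose psi (t : tops e) := mop_of_J e (val t).1.
pose R : rel (mop e) := fun u v => (u <= v)%O.
have mono t u : flip_up l l' t u -> connect R (psi t) (psi u).
  have [f _ fK] := labels_bij; rewrite -(fK t) -(fK u).
  move: (f t) (f u) => a b; rewrite /psi !labelsK => /exists_inP[g].
  rewrite inE => /existsP[c /andP[cac /eqP lc]] /eqP ft.
  suff -> : b = c by apply: connect1; case/andP: cac => /ltW.
  rewrite -(labelsK b) -(labelsK c); congr (mop_of_J _ _.1); rewrite -ft.
  by rewrite (flip_eq lin_l revlin_l' _ _ (labels_flip cac lc)) //=;
    apply: (labels_top lin_l revlin_l' ov).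
move=> /(connect_homo mono); rewrite /psi !labelsK => /connectP[s sP ->].
elim: s x sP => //= b s IHs a /andP[ab /IHs]; exact: le_trans.
Qed.

End IsomorphismEnd.

Theorem theorem4p9 (V : finType) (e : rel V) (l l' : seq V)
  (acyclic_e : acyclic e)
  (lin_l : linear_extension e l) (revlin_l' : reverse_linear_extension e l') :
  (trim (mop e) <-> is_lattice (@top_le V e l l')) /\
  (trim (mop e) ->
   exists phi : mop e -> tops e,
     [/\ forall x : mop e, val (phi x) = (Dlabels x, Ulabels x),
         bijective phi
       & forall x y : mop e, top_le l l' (phi x) (phi y) = (x <= y)%O]).
Proof.
have trim_ov : trim (mop e) -> overlapping e.
  by case/andP=> _; apply: left_modular_overlapping lin_l.
split; last first.
  move=> /trim_ov ov; exists (labels lin_l revlin_l' ov); split=> //.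
    exact: labels_bij.
  exact: labels_le.
split=> [/trim_ov ov|lat]; last first.
  apply: (overlapping_trim lin_l revlin_l').
  exact: (top_lattice_overlapping lin_l revlin_l' lat).
have [psi phiK psiK] := labels_bij lin_l revlin_l' ov.
have leE t u : top_le l l' t u = (psi t <= psi u)%O.
  by rewrite -(labels_le lin_l revlin_l' ov) !psiK.
split=> [t|t u|u t w|t u|t u].
- by rewrite leE lexx.
- by rewrite !leE => /le_anti/(can_inj psiK).
- by rewrite !leE; apply: le_trans.
- exists (labels lin_l revlin_l' ov (psi t `|` psi u)%O) => w.
  by rewrite !leE phiK leUx.
exists (labels lin_l revlin_l' ov (psi t `&` psi u)%O) => w.
by rewrite !leE phiK lexI.
Qed.
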